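(* Let $V_{hyp}\subset\mathbb{P}^{11}$ be as in the context. Then $V_{hyp}$ is birational to $F\times\mathbb{P}^1\times\mathbb{P}^1\times\mathbb{P}^1$, where $F=\mathbb{P}(\mathcal{O}_{\mathbb{P}^1}\oplus\mathcal{O}_{\mathbb{P}^1}(2))$. More precisely, with homogeneous coordinates $v_0,v_1$ (fiber coordinates of $F$, $v_0$ the section of $\mathcal{O}_F(1)$ coming from the summand $\mathcal{O}_{\mathbb{P}^1}$ and $v_1$ the one coming from $\mathcal{O}_{\mathbb{P}^1}(2)$), $w_0,w_1$ (pull-backs of coordinates of the base of $F$), and $x_0,x_1$, $y_0,y_1$, $z_0,z_1$ (coordinates of the three $\mathbb{P}^1$ factors), the rational map $F\times\mathbb{P}^1\times\mathbb{P}^1\times\mathbb{P}^1\dashrightarrow V_{hyp}$ given, writing $L=x_1w_1-x_0w_0$, by \begin{align*} a_{3,2}&=v_0^2Lx_1(x_1+x_0)y_0y_1z_1^2, & a_{3,1}&=v_0^2Lx_0(x_1+x_0)y_0y_1z_0^2,\\ a_{3,0}&=-v_1^2w_0^2w_1^2(w_1+w_0)x_0x_1(x_1+x_0)y_0y_1z_1^2, & a_{2,3}&=-v_0^2Lx_0x_1y_0^2z_1^2,\\ a_{2,1}&=-v_0^2Lx_0(x_1+x_0)y_1^2z_0^2, & a_{2,0}&=v_1^2w_0^2w_1(w_1+w_0)^2x_0x_1(x_1+x_0)y_1^2z_1^2,\\ a_{1,3}&=-v_0^2Lx_0x_1y_0^2z_0z_1, & a_{1,2}&=v_0^2Lx_1(x_1+x_0)y_1^2z_0z_1,\\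 a_{1,0}&=-v_1^2w_0w_1^2(w_1+w_0)^2x_0x_1(x_1+x_0)y_1^2z_0z_1, & a_{0,3}&=-v_0v_1w_0w_1Lx_0x_1y_0^2z_1^2,\\ a_{0,2}&=v_0v_1w_0(w_1+w_0)Lx_1(x_1+x_0)y_1^2z_1^2, & a_{0,1}&=-v_0v_1w_1(w_1+w_0)Lx_0(x_1+x_0)y_1^2z_0^2, \end{align*} is a birational map onto $V_{hyp}$.
   Context: Let $\mathbb{P}^{11}$ have homogeneous coordinates $a_{0,1},a_{0,2},a_{0,3},a_{1,0},a_{1,2},a_{1,3},a_{2,0},a_{2,1},a_{2,3},a_{3,0},a_{3,1},a_{3,2}$ (over $\mathbb{C}$, or $\mathbb{Q}$). Let $Q=V(q_0,q_1,q_2,q_3)\subset\mathbb{P}^{11}$ with $q_0=a_{1,2}a_{1,3}-a_{2,1}a_{2,3}+a_{3,1}a_{3,2}$, $q_1=a_{0,2}a_{0,3}-a_{3,0}a_{3,2}+a_{2,0}a_{2,3}$, $q_2=a_{1,0}a_{1,3}-a_{0,1}a_{0,3}+a_{3,0}a_{3,1}$, $q_3=a_{0,1}a_{0,2}-a_{1,0}a_{1,2}+a_{2,0}a_{2,1}$. Let $a$ be the $4\times6$ matrix with rows $(a_{0,1},a_{0,2},0,a_{0,3},0,0)$, $(a_{1,0},0,a_{1,2},0,a_{1,3},0)$, $(0,a_{2,0},a_{2,1},0,0,a_{2,3})$, $(0,0,0,a_{3,0},a_{3,1},a_{3,2})$. The scheme defined by the $4\times4$ minors of $a$ together with $q_0,\dots,q_3$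 has five irreducible components, four of dimension $4$ and one of dimension $5$ (codimension $6$ in $\mathbb{P}^{11}$); $V_{hyp}$ denotes this $5$-dimensional component (with its reduced structure). In the Cox ring of $F\times(\mathbb{P}^1)^3$, the degrees are $\deg v_0=(1,2,0,0,0)$, $\deg v_1=(1,0,0,0,0)$, $\deg w_i=(0,1,0,0,0)$, $\deg x_i=(0,0,1,0,0)$, $\deg y_i=(0,0,0,1,0)$, $\deg z_i=(0,0,0,0,1)$, and the twelve given forms are homogeneous of a common multidegree. *)

(* Defs.v *)
From HB Require Import structures.
From mathcomp Require Import all_boot all_order all_algebra.
From mathcomp Require Import mpoly.
Set Implicit Arguments. Unset Strict Implicit. Unset Printing Implicit Defensive.
Import GRing.Theory.
Local Open Scope ring_scope.

(* Classical projective varieties over a field K, as sets of           *)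
(* homogeneous coordinate vectors (cones minus the origin).            *)
Section Proj.
Variables (K : fieldType) (n : nat).

Definition pt := 'I_n -> K.
Definition pset := pt -> Prop.

Definition nonzero (v : pt) := exists i, v i <> 0.

Definition homogeneous (f : {mpoly K[n]}) := exists d : nat, f \is d.-homog.

Definition proj_closed (S : pset) :=
  exists F : {mpoly K[n]} -> Prop,
    (forall f, F f -> homogeneous f) /\
    (forall v, S v <-> (nonzero v /\ forall f, F f -> f.@[v] = 0)).

Definition psubset (S T : pset) := forall v, S v -> T v.

Definition irreducible (S : pset) :=
  proj_closed S /\ (exists v, S v) /\
  forall A B, proj_closed A -> proj_closed B ->
    (forall v, S v -> A v \/ B v) -> psubset S A \/ psubset S B.

Definition irr_component (X Y : pset) :=
  irreducible Y /\ psubset Y X /\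
  forall Z, irreducible Z -> psubset Y Z -> psubset Z X -> psubset Z Y.

Definition has_chain (Y : pset) (m : nat) :=
  exists C : nat -> pset,
    (forall i, (i <= m)%N -> irreducible (C i)) /\
    (forall i, (i < m)%N -> psubset (C i) (C i.+1) /\ ~ psubset (C i.+1) (C i)) /\
    psubset (C m) Y.

Definition pdim (Y : pset) (d : nat) := has_chain Y d /\ ~ has_chain Y d.+1.

Definition pequiv (q q' : pt) :=
  nonzero q /\ exists l : K, l <> 0 /\ forall i, q' i = l * q i.

End Proj.

Section Target.
Variable K : fieldType.
Local Notation P := {mpoly K[12]}.
Definition A (k : nat) : P := 'X_(inord k).
Definition a01 := A 0. Definition a02 := A 1. Definition a03 := A 2.
Definition a10 := A 3. Definition a12 := A 4. Definition a13 := A 5.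
Definition a20 := A 6. Definition a21 := A 7. Definition a23 := A 8.
Definition a30 := A 9. Definition a31 := A 10. Definition a32 := A 11.

Definition q0 : P := a12 * a13 - a21 * a23 + a31 * a32.
Definition q1 : P := a02 * a03 - a30 * a32 + a20 * a23.
Definition q2 : P := a10 * a13 - a01 * a03 + a30 * a31.
Definition q3 : P := a01 * a02 - a10 * a12 + a20 * a21.

Definition rowsA : seq (seq P) :=
  [:: [:: a01; a02; 0; a03; 0; 0];
      [:: a10; 0; a12; 0; a13; 0];
      [:: 0; a20; a21; 0; 0; a23];
      [:: 0; 0; 0; a30; a31; a32]].

Definition amat : 'M[P]_(4, 6) :=
  \matrix_(i < 4, j < 6) nth 0 (nth [::] rowsA i) j.

Definition Xhyp : pset K 12 := fun v =>
  nonzero v /\ q0.@[v] = 0 /\ q1.@[v] = 0 /\ q2.@[v] = 0 /\ q3.@[v] = 0 /\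
  forall c : 'I_4 -> 'I_6, (\det (colsub c amat)).@[v] = 0.
End Target.

(* F x P^1 x P^1 x P^1 via its Cox ring K[v0,v1,w0,w1,x0,x1,y0,y1,z0,z1] *)
(* (coordinate order 0..9), graded by Z^5 with                          *)
(* deg v0=(1,2,0,0,0), deg v1=(1,0,0,0,0), deg w=(0,1,0,0,0),           *)
(* deg x=(0,0,1,0,0), deg y=(0,0,0,1,0), deg z=(0,0,0,0,1).             *)
Section Source.
Variable K : fieldType.
Local Notation c p k := (p (inord k : 'I_10)).

Definition relevant (p : pt K 10) :=
  (c p 0 <> 0 \/ c p 1 <> 0) /\ (c p 2 <> 0 \/ c p 3 <> 0) /\
  (c p 4 <> 0 \/ c p 5 <> 0) /\ (c p 6 <> 0 \/ c p 7 <> 0) /\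
  (c p 8 <> 0 \/ c p 9 <> 0).

Definition tact (s t a b e : K) (p : pt K 10) : pt K 10 := fun i =>
  match val i with
  | 0 => s * t ^+ 2 * p i
  | 1 => s * p i
  | 2 | 3 => t * p i
  | 4 | 5 => a * p i
  | 6 | 7 => b * p i
  | _ => e * p i
  end.

Definition sequiv (p p' : pt K 10) :=
  relevant p /\ exists s t a b e : K,
    s <> 0 /\ t <> 0 /\ a <> 0 /\ b <> 0 /\ e <> 0 /\ p' = tact s t a b e p.

Definition Phi (p : pt K 10) : pt K 12 :=
  let v0 := c p 0 in let v1 := c p 1 in
  let w0 := c p 2 in let w1 := c p 3 in
  let x0 := c p 4 in let x1 := c p 5 in
  let y0 := c p 6 in let y1 := c p 7 in
  let z0 := c p 8 in let z1 := c p 9 in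
  let L := x1 * w1 - x0 * w0 in
  fun i => match val i with
  | 0 => - (v0 * v1 * w1 * (w1 + w0) * L * x0 * (x1 + x0) * y1 ^+ 2 * z0 ^+ 2)
  | 1 => v0 * v1 * w0 * (w1 + w0) * L * x1 * (x1 + x0) * y1 ^+ 2 * z1 ^+ 2
  | 2 => - (v0 * v1 * w0 * w1 * L * x0 * x1 * y0 ^+ 2 * z1 ^+ 2)
  | 3 => - (v1 ^+ 2 * w0 * w1 ^+ 2 * (w1 + w0) ^+ 2 * x0 * x1 * (x1 + x0)
              * y1 ^+ 2 * z0 * z1)
  | 4 => v0 ^+ 2 * L * x1 * (x1 + x0) * y1 ^+ 2 * z0 * z1
  | 5 => - (v0 ^+ 2 * L * x0 * x1 * y0 ^+ 2 * z0 * z1)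
  | 6 => v1 ^+ 2 * w0 ^+ 2 * w1 * (w1 + w0) ^+ 2 * x0 * x1 * (x1 + x0)
           * y1 ^+ 2 * z1 ^+ 2
  | 7 => - (v0 ^+ 2 * L * x0 * (x1 + x0) * y1 ^+ 2 * z0 ^+ 2)
  | 8 => - (v0 ^+ 2 * L * x0 * x1 * y0 ^+ 2 * z1 ^+ 2)
  | 9 => - (v1 ^+ 2 * w0 ^+ 2 * w1 ^+ 2 * (w1 + w0) * x0 * x1 * (x1 + x0)
              * y0 * y1 * z1 ^+ 2)
  | 10 => v0 ^+ 2 * L * x0 * (x1 + x0) * y0 * y1 * z0 ^+ 2
  | _ => v0 ^+ 2 * L * x1 * (x1 + x0) * y0 * y1 * z1 ^+ 2
  end.

Definition evalPsi (Psi : 'I_10 -> {mpoly K[12]}) (q : pt K 12) : pt K 10 :=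
  fun i => (Psi i).@[q].

Definition pscale (l : K) (q : pt K 12) : pt K 12 := fun i => l * q i.
End Source.

(* Main.v *)
(* Regard a_ij as a weight on the ordered pair (i, j). After flipping the signs of
   a_02, a_13, a_20 and a_31, all equations become symmetric in the four indices: the minors
   vanish iff some u <> 0 satisfies u_i b_ij + u_j b_ji = 0 for all i < j, and the quadrics say
   b_ij b_ik + b_ji b_jk + b_ki b_kj = 0 for every triple.

   - On the torus, where no coordinate vanishes, the twelve coordinates of Phi can be inverted
     by monomials, because x_1 + x_0, w_1 + w_0 and L become monomials modulo the equations.
     Hence every torus point of Xhyp is, up to scaling, in the image of Phi.
   - The points of Xhyp off the torus have dimension at most 4: sorting them by the support of
     the kernel vector u, finitely many families in four parameters (and a scaling factor)
     exhaust them. A chain of length m of irreducible closed sets forces binomial(m + k, m)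
     linearly independent forms of degree k E, too many on such a family if m = 5.

   So a 5-dimensional component V meets the torus, whence V is contained in the closure W of the
   image of Phi; W is irreducible and contained in Xhyp, so V = W. *)
Require Import Defs.
From HB Require Import structures.
From mathcomp Require Import all_boot all_order all_algebra.
From mathcomp Require Import perm mpoly.
From mathcomp Require Import ring zify.
From Stdlib Require Import Classical FunctionalExtensionality.
Set Implicit Arguments. Unset Strict Implicit. Unset Printing Implicit Defensive.
Import GRing.Theory.
Local Open Scope ring_scope.

Local Notation "q # k" := (q (inord k)) (at level 2, k at level 1, format "q # k").

(** * Nonzero polynomials over an algebraically closed field have points off their zero locus *)

Lemma digits_inj (B n : nat) (a b : 'I_n -> nat) :
  (forall i, (a i < B)%N) -> (forall i, (b i < B)%N) ->
  (\sum_(i < n) a i * B ^ i = \sum_(i < n) b i * B ^ i)%N -> a =1 b.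
Proof.
elim: n a b => [|n IH] a b ltaB ltbB; first by move=> _ [].
have sumS (c : 'I_n.+1 -> nat) : (\sum_(i < n.+1) c i * B ^ i
    = c ord0 + (\sum_(i < n) c (lift ord0 i) * B ^ i) * B)%N.
  rewrite big_ord_recl expn0 muln1 big_distrl /=; congr addn.
  by apply: eq_bigr => i _; rewrite /bump /= add1n expnS; lia.
rewrite !sumS => E.
have B0 : (0 < B)%N by apply: leq_ltn_trans (ltaB ord0).
have Ea0 : a ord0 = b ord0.
  by have := congr1 (modn^~ B) E; rewrite !(addnC _ (_ * B)%N) !modnMDl !modn_small.
have Es : a \o lift ord0 =1 b \o lift ord0.
  apply: IH => [i|i|]; [exact: ltaB | exact: ltbB |].
  by move/eqP: E; rewrite Ea0 eqn_add2l eqn_pmul2r // => /eqP.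
by move=> i; case: (unliftP ord0 i) => [j ->|-> //]; apply: Es.
Qed.

(* Kronecker substitution x_i := t ^ (B ^ i), injective on the monomials of f. *)
Lemma mpoly_nonroot (K : closedFieldType) n (f : {mpoly K[n]}) :
  f != 0 -> exists v, f.@[v] != 0.
Proof.
move=> f0.
pose B := msize f; pose wt (m : 'X_{1..n}) := (\sum_(i < n) m i * B ^ i)%N.
pose F : {poly K} := \sum_(m <- msupp f) f@_m *: 'X^(wt m).
have wt_inj : {in msupp f &, injective wt}.
  have ltB m : m \in msupp f -> forall i, (m i < B)%N.
    move=> /msize_mdeg_lt lt i; apply: leq_ltn_trans lt.
    by rewrite mdegE (bigD1 i) //= leq_addr.
  by move=> m m' hm hm' E; apply/mnmP; apply: digits_inj E; apply: ltB.
have F0 : F != 0.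
  (* Distinct monomials of [f] get distinct exponents, so the coefficient at the weight of the
     leading monomial is just the leading coefficient. *)
  apply/eqP => /(congr1 (fun p : {poly K} => p`_(wt (mlead f)))).
  rewrite coef0 coef_sum (bigD1_seq (mlead f)) ?mlead_supp ?msupp_uniq //=.
  rewrite coefZ coefXn eqxx mulr1 big_seq_cond big1 ?addr0 => [/eqP|m /andP[hm ne]].
    by rewrite mleadc_eq0 (negPf f0).
  rewrite coefZ coefXn; case: eqP => [/wt_inj E|_]; last by rewrite mulr0.
  by move: ne; rewrite -E ?eqxx // mlead_supp.
have /closed_nonrootP [t] := F0; rewrite /root => Ft.
exists (fun i => t ^+ (B ^ i)); apply: contraNneq Ft.
rewrite mevalE horner_sum => E; apply/eqP; rewrite -[RHS]E; apply: eq_bigr => m _.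
rewrite hornerZ hornerXn /wt expr_sum; congr (_ * _).
by apply: eq_bigr => i _; rewrite -exprM mulnC.
Qed.

(** * Projective closed sets, chains, and linearly independent forms *)

Section Projective.
Variables (K : fieldType) (n : nat).
Implicit Types (f g : {mpoly K[n]}) (S C : pset K n) (v w : pt K n).

Lemma meval_homog_scale f d (c : K) v : f \is d.-homog ->
  f.@[fun i => c * v i] = c ^+ d * f.@[v].
Proof.
move=> /dhomogP fd; rewrite !mevalE mulr_sumr !big_seq; apply: eq_bigr => m /fd md.
have <- : mdeg m = d := md; rewrite mulrCA; congr (_ * _); rewrite mdegE expr_sum -big_split /=.
by apply: eq_bigr => i _; rewrite exprMn.
Qed.

Lemma proj_closed_hypersurface f : homogeneous f ->
  proj_closed (fun v => nonzero v /\ f.@[v] = 0).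
Proof.
move=> hf; exists (eq f); split=> [_ <- //|v].
split=> -[nzv fv]; split=> //; [by move=> _ <- | exact: fv].
Qed.

Lemma irreducible_nonzero S v : irreducible S -> S v -> nonzero v.
Proof. by move=> [[F [_ HF]] _] /HF []. Qed.

(** The zero loci of [f] and [g] are closed and cover [S], so one of them contains it. *)
Lemma irreducible_mulf S f g : irreducible S -> homogeneous f -> homogeneous g ->
  (forall v, S v -> f.@[v] * g.@[v] = 0) ->
  (forall v, S v -> f.@[v] = 0) \/ (forall v, S v -> g.@[v] = 0).
Proof.
move=> irrS hf hg fg0; have [_ [_ Sprime]] := irrS.
have [v Sv|Sf|Sg] := Sprime _ _ (proj_closed_hypersurface hf) (proj_closed_hypersurface hg).
- have nzv := irreducible_nonzero irrS Sv.
  by have /eqP := fg0 v Sv; rewrite mulf_eq0 => /orP[] /eqP; [left|right].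
- by left=> v /Sf [].
- by right=> v /Sg [].
Qed.

(* Multiplying by a coordinate makes the degree of the separating form positive. *)
Lemma proj_closed_separating C v : proj_closed C -> nonzero v -> ~ C v ->
  exists d f, [/\ (0 < d)%N, f \is d.-homog, forall w, C w -> f.@[w] = 0 & f.@[v] != 0].
Proof.
move=> [F [homF CE]] nzv nCv.
have [f Ff fv] : exists2 f, F f & f.@[v] <> 0.
  apply: NNPP => H; apply: nCv; apply/CE; split=> // f Ff.
  by apply: NNPP => fv; apply: H; exists f.
have [d fd] := homF _ Ff; have [i /eqP vi] := nzv.
exists (d + 1)%N, (f * 'X_i); split.
- by rewrite addn1.
- by apply: dhomogM => //; rewrite dhomogX /= mdeg1.
- by move=> w /CE [_ /(_ f Ff) fw]; rewrite mevalM fw mul0r.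
- by rewrite mevalM mevalXU mulf_neq0 //; apply/eqP.
Qed.

(** Independence as functions on [C], that is, in the degree [d] part of its homogeneous coordinate
    ring. Coefficients are indexed by [nat] so that lists can be concatenated. *)
Definition indep_forms C d (s : seq {mpoly K[n]}) :=
  {in s, forall f, f \is d.-homog} /\
  forall c : nat -> K,
    (forall v, C v -> \sum_(i < size s) c i * (s`_i).@[v] = 0) ->
    forall i, (i < size s)%N -> c i = 0.

(** On [C] the form [g] vanishes, so a relation restricted to [C] kills the coefficients of [s2].
    What remains is [g] times a combination of [s1], and [g] can be cancelled because [D] is
    irreducible. *)
Lemma indep_forms_cat C D d e g s1 s2 :
  irreducible D -> g \is e.-homog -> (forall v, C v -> g.@[v] = 0) ->
  (exists2 v, D v & g.@[v] != 0) -> psubset C D ->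
  indep_forms D d s1 -> indep_forms C (d + e) s2 ->
  indep_forms D (d + e) (s2 ++ [seq f * g | f <- s1]).
Proof.
move=> irrD ge gC [v0 Dv0 gv0] CD [hom1 ind1] [hom2 ind2]; split=> [f|c Hc].
  rewrite mem_cat => /orP[/hom2 //|/mapP [h /hom1 hh ->]]; exact: dhomogM.
have Hc' v : D v -> \sum_(i < size s2) c i * (s2`_i).@[v]
    + (\sum_(i < size s1) c (size s2 + i)%N * (s1`_i).@[v]) * g.@[v] = 0.
  move=> /Hc; rewrite size_cat size_map big_split_ord /= => E; rewrite -[RHS]E; congr (_ + _).
    by apply: eq_bigr => i _; rewrite nth_cat ltn_ord.
  rewrite mulr_suml; apply: eq_bigr => i _.
  rewrite nth_cat ltnNge leq_addr /= addKn (nth_map 0) // mevalM; ring.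
have c2 i : (i < size s2)%N -> c i = 0.
  by apply: ind2 => v Cv; have := Hc' v (CD v Cv); rewrite gC // mulr0 addr0.
pose G := \sum_(i < size s1) c (size s2 + i)%N *: s1`_i.
have GE v : G.@[v] = \sum_(i < size s1) c (size s2 + i)%N * (s1`_i).@[v].
  rewrite /G raddf_sum /=. by apply: eq_bigr => i _; rewrite mevalZ.
have homG : G \is d.-homog.
  by apply: rpred_sum => i _; apply: rpredZ; apply: hom1; rewrite mem_nth.
have [|||G0|g0] := @irreducible_mulf D G g irrD.
- by exists d.
- by exists e.
- move=> v Dv; have := Hc' v Dv; rewrite big1 ?add0r ?GE // => i _.
  by rewrite c2 // mul0r.
- have c1 := ind1 (fun i => c (size s2 + i)%N) (fun v Dv => etrans (esym (GE v)) (G0 v Dv)).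
  move=> i; rewrite size_cat size_map => lti.
  have [/c2 //|le] := ltnP i (size s2).
  by rewrite -(subnKC le); apply: c1; rewrite ltn_subLR.
- by move: gv0; rewrite g0 ?eqxx.
Qed.

Definition chain (C : nat -> pset K n) m :=
  (forall i, (i <= m)%N -> irreducible (C i)) /\
  (forall i, (i < m)%N -> psubset (C i) (C i.+1) /\ ~ psubset (C i.+1) (C i)).

(** Each step of the chain yields a form which vanishes on the smaller set but not on the larger
    one. *)
Lemma chain_flag (C : nat -> pset K n) m : chain C m ->
  exists E (f : nat -> {mpoly K[n]}), [/\ (0 < E)%N,
    forall i, (i <= m)%N -> f i \is E.-homog,
    forall i v, (i < m)%N -> C i v -> (f i.+1).@[v] = 0 &
    forall i, (i <= m)%N -> exists2 v, C i v & (f i).@[v] != 0].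
Proof.
elim: m => [|m IH] [irrC incC].
  have irr0 := irrC 0%N isT; have [_ [[v Cv] _]] := irr0.
  have [i /eqP vi] := irreducible_nonzero irr0 Cv.
  exists 1%N, (fun=> 'X_i); split=> // [j _|[]// _].
    by rewrite dhomogX /= mdeg1.
  by exists v; rewrite ?mevalXU.
have [|E [f [E0 homf f0 fn0]]] := IH.
  by split=> i lei; [apply: irrC; apply: leqW | apply: incC; apply: leqW].
have [_ nsub] := incC m (leqnn _).
have [v Cv nCv] : exists2 v, C m.+1 v & ~ C m v.
  apply: NNPP => H; apply: nsub => v Cv.
  by apply: NNPP => nCv; apply: H; exists v.
have [d [g [d0 gd gC gv]]] := proj_closed_separating (irrC m (leqnSn m)).1
  (irreducible_nonzero (irrC _ (leqnn _)) Cv) nCv.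
(* Powers bring the old forms, of degree [E], and the new one, of degree [d], to a common degree
   without changing their zeros. *)
exists (E * d)%N, (fun i => if i == m.+1 then g ^+ E else f i ^+ d); split.
- by rewrite muln_gt0 E0.
- move=> i lei; case: eqP => [_|/eqP ne]; first by rewrite mulnC; apply: dhomogMn.
  by apply: dhomogMn; apply: homf; rewrite -ltnS ltn_neqAle ne.
- move=> i w lti Cw; rewrite eqSS; case: eqP => [E1|/eqP ne]; rewrite rmorphXn /=.
    by rewrite gC ?expr0n -?E1 // (gtn_eqF E0).
  by rewrite f0 ?expr0n ?(gtn_eqF d0) // ltn_neqAle ne -ltnS.
- move=> i lei; case: eqP => [->|/eqP ne].
    by exists v; rewrite // rmorphXn expf_neq0.
  have [|w Cw fw] := fn0 i; first by rewrite -ltnS ltn_neqAle ne.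
  by exists w; rewrite // rmorphXn expf_neq0.
Qed.

(* Restriction to C (m-1) and division by f_m give Pascal's recursion
   h_m(k) = h_(m-1)(k) + h_m(k-1) for the number of independent forms. *)
Lemma chain_indep_forms (C : nat -> pset K n) m : chain C m ->
  exists2 E, (0 < E)%N & forall k, exists2 s, size s = 'C(m + k, m) &
    indep_forms (C m) (k * E) s.
Proof.
move=> chC; have [irrC incC] := chC.
have [E [f [E0 homf f0 fn0]]] := chain_flag chC; exists E => //.
elim: {-2}m (leqnn m) => [|j IHj] lej k.
  have [v Cv fv] := fn0 0%N isT; exists [:: f 0%N ^+ k]; first by rewrite bin0.
  split=> [g|c Hc [|//] _]; first by rewrite inE => /eqP->; rewrite mulnC dhomogMn ?homf.
  have /eqP := Hc v Cv; rewrite big_ord1 /= rmorphXn /= mulf_eq0 => /orP[/eqP //|].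
  by rewrite expf_eq0 (negPf fv) andbF.
elim: k => [|k [s1 sz1 ind1]].
  exists [:: 1]; first by rewrite addn0 binn.
  split=> [g|c Hc [|//] _]; first by rewrite inE => /eqP->; apply: dhomog1.
  have [v Cv _] := fn0 _ lej.
  by have := Hc v Cv; rewrite big_ord1 /= meval1 mulr1.
have [s2 sz2 ind2] := IHj (ltnW lej) k.+1.
exists (s2 ++ [seq g * f j.+1 | g <- s1]).
  by rewrite size_cat size_map sz1 sz2 !addSn !addnS binS addnC.
rewrite mulSn addnC; apply: (@indep_forms_cat (C j)) => //.
- exact: irrC.
- exact: homf.
- by move=> v; apply: f0.
- exact: fn0.
- by have [] := incC j lej.
- by rewrite addnC -mulSn.
Qed.

End Projective.

(** * Dimension bound for sets covered by polynomial images *)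

Lemma leq_expn_bin m k : (k ^ m <= 'C(m + k, m) * m`!)%N.
Proof.
elim: m => [|m IH]; first by rewrite bin0.
(* The right-hand side is the product (k + 1) ... (k + m); this splits off its top factor. *)
rewrite factS mulnA (mulnC 'C(_, _)) -mul_bin_diag addSn /= -mulnA expnS.
by apply: leq_mul IH; apply: ltnW; rewrite ltnS leq_addl.
Qed.

Lemma row_kernel (F : fieldType) m n (M : 'M[F]_(m, n)) : (n < m)%N ->
  exists2 u : 'rV_m, u != 0 & u *m M = 0.
Proof.
move=> ltnm; have /rowV0Pn [u /sub_kermxP uM u0] : kermx M != 0.
  by rewrite kermx_eq0 /row_free neq_ltn (leq_ltn_trans (rank_leq_col _)).
by exists u.
Qed.

Section Covered.
Variable K : fieldType.

Lemma meval_scale_eq n (f : {mpoly K[n]}) d c v w : f \is d.-homog ->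
  (forall i, c * v i = w i) -> f.@[w] = c ^+ d * f.@[v].
Proof. by move=> fd E; rewrite -(meval_homog_scale _ _ fd); apply: meval_eq => i. Qed.

(** Since [msize] of a nonzero polynomial is its degree plus one, the bounds mean degree at most [D]
    and at most [d * D]. *)
Lemma msize_comp_homog n k (f : {mpoly K[n]}) d (phi : 'I_n -> {mpoly K[k]}) D :
  f \is d.-homog -> (forall i, (msize (phi i) <= D.+1)%N) ->
  (msize (f \mPo [tuple phi i | i < n]) <= (d * D).+1)%N.
Proof.
move=> /dhomogP fd phiD.
have msizeM_bound (p q : {mpoly K[k]}) a b :
    (msize p <= a.+1)%N -> (msize q <= b.+1)%N -> (msize (p * q) <= (a + b).+1)%N.
  move=> pa qb; have [->|p0] := eqVneq p 0; first by rewrite mul0r msize0.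
  have [->|q0] := eqVneq q 0; first by rewrite mulr0 msize0.
  rewrite msizeM //; move: (msize p) (msize q) pa qb => x y; lia.
rewrite comp_mpolyEX; apply: leq_trans (msize_sum _ _ _) _.
rewrite big_seq; apply/bigmax_leqP_seq => m mf _; apply: leq_trans (msizeZ_le _ _) _.
rewrite comp_mpolyX; have <- : mdeg m = d := fd m mf.
rewrite mdegE big_distrl /=.
elim/big_ind2: _ => [|p a q b|i _]; first by rewrite msize1.
  by move=> ? ?; apply: msizeM_bound.
rewrite tnth_mktuple; elim: (m i) => [|e IH]; first by rewrite expr0 msize1.
by rewrite exprS mulSn; apply: msizeM_bound.
Qed.

(* S lies in a finite union of cones over polynomial images of affine k-space,
   so dim S <= k projectively. *)
Definition covered (I : Type) k (S : (I -> K) -> Prop) : Type :=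
  {J : finType & {phi : J -> I -> {mpoly K[k]} |
    forall v, S v -> exists j c t, c != 0 /\ forall i, c * v i = (phi j i).@[t]}}.

Lemma covered_sub I k (S T : (I -> K) -> Prop) :
  (forall v, S v -> T v) -> covered k T -> covered k S.
Proof. by move=> ST [J [phi H]]; exists J, phi => v /ST /H. Qed.

Lemma covered_or I k (S T : (I -> K) -> Prop) :
  covered k S -> covered k T -> covered k (fun v => S v \/ T v).
Proof.
move=> [J [phi H]] [J' [phi' H']].
exists (J + J')%type, (fun j => match j with inl j => phi j | inr j => phi' j end).
by move=> v [/H|/H'] [j [c [t X]]]; [exists (inl j)|exists (inr j)]; exists c, t.
Qed.

(** Transport along a relabelling of coordinates with constant factors, needed to return from edge
    values to the twelve coordinates. *)
Lemma covered_monomial I I' k (rho : I -> I') (e : I -> K)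
    (S : (I -> K) -> Prop) (T : (I' -> K) -> Prop) :
  (forall v, S v -> exists2 w, T w & forall i, v i = e i * w (rho i)) ->
  covered k T -> covered k S.
Proof.
move=> ST [J [phi H]]; exists J, (fun j i => e i *: phi j (rho i)) => v.
move=> /ST [w /H [j [c [t [c0 E]]]] vE]; exists j, c, t; split=> // i.
by rewrite mevalZ -E vE mulrCA.
Qed.

(** Scaling makes one nonzero coordinate equal to 1; the other [k] possibly nonzero ones serve as
    parameters. *)
Lemma covered_support (I : finType) k :
  covered k (fun v : I -> K =>
    (exists i, v i <> 0) /\ exists2 s : seq I, (size s <= k.+1)%N & forall i, v i != 0 -> i \in s).
Proof.
exists (I * {ffun 'I_k -> I})%type.
exists (fun (j : I * {ffun 'I_k -> I}) i => if i == j.1 then 1 : {mpoly K[k]} else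
  if [pick l | j.2 l == i] is Some l then 'X_l else 0).
move=> v [[i0 /eqP vi0] [s szs sP]].
pose r := rem i0 s.
have szr : (size r <= k)%N by rewrite size_rem ?sP //; case: size szs.
(* Positions beyond the end of [r] default to [i0], which is harmless because the first test of the
   map already settles that index. *)
exists (i0, [ffun l : 'I_k => nth i0 r l]), (v i0)^-1.
exists (fun l => (v i0)^-1 * v (nth i0 r l)); split; first by rewrite invr_eq0.
move=> i; case: eqP => /= [->|/eqP ne]; first by rewrite meval1 mulVf.
case: pickP => [l /eqP|no_l]; first by rewrite ffunE => <-; rewrite mevalXU.
have [->|vi] := eqVneq (v i) 0; first by rewrite mulr0 meval0.
have ir : i \in r.
  have := sP i vi; rewrite (perm_mem (perm_to_rem (sP _ vi0))) inE => /orP[|//].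
  by rewrite (negPf ne).
have ltk : (index i r < k)%N by apply: leq_trans szr; rewrite index_mem.
by have := no_l (Ordinal ltk); rewrite ffunE /= nth_index ?eqxx.
Qed.

(** Pulled back to the parameters, a form of degree [d] has all exponents at most [d * D], so each
    piece sees at most (d D + 1)^k monomials. With more forms than that over all pieces together,
    one linear relation holds on every piece at once. *)
Lemma covered_indep_forms n k (S : pset K n) : covered k S ->
  exists R D : nat, forall d s, indep_forms S d s -> (size s <= R * (d * D).+1 ^ k)%N.
Proof.
move=> [J [phi H]].
pose D := (\max_(j : J) \max_(i < n) msize (phi j i))%N.
have phiD j i : (msize (phi j i) <= D.+1)%N.
  apply: leqW; apply: leq_trans (leq_bigmax j).
  exact: (@leq_bigmax _ (fun i => msize (phi j i)) i).
exists #|J|, D => d s [homs inds].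
pose T := (J * {ffun 'I_k -> 'I_(d * D).+1})%type.
have -> : (#|J| * (d * D).+1 ^ k)%N = #|{: T}| by rewrite card_prod card_ffun !card_ord.
rewrite leqNgt; apply/negP => /row_kernel Hker.
pose comp j i := s`_i \mPo [tuple phi j l | l < n].
pose mon (a : T) := [multinom (a.2 l : nat) | l < k].
have [u u0 uM] := Hker K (\matrix_(i, a) (comp (enum_val a).1 (i : nat))@_(mon (enum_val a))).
(* [c] extends [u] by zero to all of [nat], as [indep_forms] expects. *)
pose c i := if insub i is Some i' then u 0 i' else 0.
have cE (i : 'I_(size s)) : c i = u 0 i.
  by rewrite /c; case: insubP => [i' _ /val_inj -> //|]; rewrite ltn_ord.
have P0 j : \sum_(i < size s) c i *: comp j i = 0.
  apply/mpolyP => m; rewrite mcoeff0 raddf_sum /=.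
  have [mD|mD] := leqP (mdeg m) (d * D); last first.
    apply: big1 => i _; rewrite mcoeffZ; have [/eqP->|] := boolP ((comp j i)@_m == 0).
      by rewrite mulr0.
    rewrite -mcoeff_msupp => /msize_mdeg_lt; have := @msize_comp_homog _ _ _ d (phi j) D
      (homs _ (mem_nth 0 (ltn_ord i))) (phiD j).
    rewrite -/(comp j i); lia.
  have lt_m l : (m l < (d * D).+1)%N.
    by rewrite ltnS; apply: leq_trans mD; rewrite mdegE (bigD1 l) //= leq_addr.
  pose a : T := (j, [ffun l => Ordinal (lt_m l)]).
  have := congr1 (fun M : 'rV_ _ => M 0 (enum_rank a)) uM; rewrite !mxE.
  move=> E; rewrite -[RHS]E; apply: eq_bigr => i _.
  rewrite mxE enum_rankK mcoeffZ cE /=; congr (_ * mcoeff _ _).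
  by apply/mnmP => l; rewrite mnmE ffunE.
case/eqP: u0; apply/rowP => i; rewrite mxE -cE.
apply: (inds c _ i (ltn_ord i)) => v /H [j [b [t [b0 E]]]].
apply: (mulfI (expf_neq0 d b0)); rewrite mulr0 mulr_sumr.
have := congr1 (meval t) (P0 j); rewrite raddf_sum meval0 /= => E0; rewrite -[RHS]E0.
apply: eq_bigr => l _; rewrite mevalZ mulrCA; congr (_ * _).
rewrite comp_mpoly_meval; apply/esym/meval_scale_eq => [|x]; first exact/homs/mem_nth.
by rewrite tnth_mktuple E.
Qed.

(** Along a chain of length k + 1 the number of independent forms of degree k' E grows like k'^(k +
    1), whereas the covering allows only a multiple of k'^k. *)
Lemma covered_no_chain n k (S : pset K n) : covered k S -> ~ has_chain S k.+1.
Proof.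
move=> covS [C [irrC [incC CS]]].
have [R [D HRD]] := covered_indep_forms (covered_sub CS covS).
have [E E0 HE] := chain_indep_forms (conj irrC incC).
(* Chosen so that the upper bound times (k + 1)! is at most (k' - 1) k'^k, which is less than k'^(k
   + 1). *)
pose k' := (k.+1`! * R * (E * D).+1 ^ k).+1.
have [s sz_s /HRD le_s] := HE k'; move: le_s; rewrite sz_s.
apply/negP; rewrite -ltnNge.
rewrite -(ltn_pmul2r (fact_gt0 k.+1)); apply: leq_trans (leq_expn_bin _ _).
apply: (@leq_ltn_trans (k'.-1 * k' ^ k)); last by rewrite expnS ltn_pmul2r ?expn_gt0.
have le_k : ((k' * E * D).+1 ^ k <= ((E * D).+1 * k') ^ k)%N.
  case: (k) => // e; rewrite leq_exp2r // mulSn -mulnA mulnC.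
  by rewrite -addn1 addnC leq_add2r.
apply: leq_trans (leq_mul (leq_mul (leqnn R) le_k) (leqnn k.+1`!)) _.
by rewrite expnMn /= mulnC -!mulnA.
Qed.

End Covered.

(** * The equations of [Xhyp] in coordinates and their homogeneity *)

Lemma dhomog_prod_linear (R : comNzRingType) n m (F : 'I_m -> {mpoly R[n]}) :
  (forall i, F i \is 1.-homog) -> \prod_i F i \is m.-homog.
Proof.
move=> FH; have H (r : seq 'I_m) : \prod_(i <- r) F i \is (size r).-homog.
  elim: r => [|i r IH]; first by rewrite big_nil dhomog1.
  by rewrite big_cons; apply: (dhomogM (FH i) IH).
by have := H (enum 'I_m); rewrite size_enum_ord big_enum.
Qed.

Section Equations.
Variable K : fieldType.
Implicit Types q : pt K 12.

Lemma ord4P (P : 'I_4 -> Prop) :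
  P (inord 0) -> P (inord 1) -> P (inord 2) -> P (inord 3) -> forall i, P i.
Proof.
move=> P0 P1 P2 P3 i; rewrite -(inord_val i).
by case: i => [[|[|[|[|m]]]] lt].
Qed.

Lemma ord6P (P : 'I_6 -> Prop) : P (inord 0) -> P (inord 1) -> P (inord 2) ->
  P (inord 3) -> P (inord 4) -> P (inord 5) -> forall i, P i.
Proof.
move=> P0 P1 P2 P3 P4 P5 i; rewrite -(inord_val i).
by case: i => [[|[|[|[|[|[|m]]]]]] lt].
Qed.

Lemma ord12P (P : 'I_12 -> Prop) :
  P (inord 0) -> P (inord 1) -> P (inord 2) -> P (inord 3) -> P (inord 4) -> P (inord 5) ->
  P (inord 6) -> P (inord 7) -> P (inord 8) -> P (inord 9) -> P (inord 10) -> P (inord 11) ->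
  forall i, P i.
Proof.
move=> ? ? ? ? ? ? ? ? ? ? ? ? i; rewrite -(inord_val i).
by case: i => [[|[|[|[|[|[|[|[|[|[|[|[|m]]]]]]]]]]]] lt].
Qed.

Definition quadric_eqs q :=
  [/\ q#4 * q#5 - q#7 * q#8 + q#10 * q#11 = 0,
      q#1 * q#2 - q#9 * q#11 + q#6 * q#8 = 0,
      q#3 * q#5 - q#0 * q#2 + q#9 * q#10 = 0 &
      q#0 * q#1 - q#3 * q#4 + q#6 * q#7 = 0].

(** Column ij of [amat] has only the entries a_ij and a_ji, so a left kernel vector gives one
    two-term equation for each pair. *)
Definition kernel_eqs (u : 'I_4 -> K) q :=
  [/\ u#0 * q#0 + u#1 * q#3 = 0, u#0 * q#1 + u#2 * q#6 = 0 & u#1 * q#4 + u#2 * q#7 = 0] /\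
  [/\ u#0 * q#2 + u#3 * q#9 = 0, u#1 * q#5 + u#3 * q#10 = 0 & u#2 * q#8 + u#3 * q#11 = 0].

Lemma quadric_eqsP q : quadric_eqs q <->
  (q0 K).@[q] = 0 /\ (q1 K).@[q] = 0 /\ (q2 K).@[q] = 0 /\ (q3 K).@[q] = 0.
Proof.
rewrite /q0 /q1 /q2 /q3 !(mevalD, mevalN, mevalM, mevalXU).
by split=> [[]|[? [? []]]].
Qed.

Lemma kernel_eqsP (u : 'I_4 -> K) q : kernel_eqs u q <->
  (\row_i u i) *m map_mx (meval q) (amat K) = 0.
Proof.
have uM (j : 'I_6) : ((\row_i u i) *m map_mx (meval q) (amat K)) 0 j =
    \sum_i u i * (nth 0 (nth [::] (rowsA K) i) j).@[q].
  by rewrite mxE; apply: eq_bigr => i _; rewrite !mxE.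
have sum4 (F : 'I_4 -> K) : \sum_i F i = F#0 + F#1 + F#2 + F#3.
  rewrite !big_ord_recl big_ord0 addr0 !addrA.
  by congr (_ + _ + _ + _); congr F; apply: val_inj; rewrite /= inordK.
have uM4 (j : 'I_6) : ((\row_i u i) *m map_mx (meval q) (amat K)) 0 j =
    u#0 * (nth 0 (nth [::] (rowsA K) 0) j).@[q] + u#1 * (nth 0 (nth [::] (rowsA K) 1) j).@[q]
  + u#2 * (nth 0 (nth [::] (rowsA K) 2) j).@[q] + u#3 * (nth 0 (nth [::] (rowsA K) 3) j).@[q].
  by rewrite uM sum4 !inordK.
split=> [[[e0 e1 e2] [e3 e4 e5]]|E].
  apply/rowP => j; rewrite uM4 mxE.
  elim/ord6P: j; rewrite !inordK //= !meval0 !mevalXU !mulr0 ?addr0 ?add0r //.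
have uM0 j : ((\row_i u i) *m map_mx (meval q) (amat K)) 0 j = 0 by rewrite E mxE.
split; split; [have := uM0 (inord 0)|have := uM0 (inord 1)|have := uM0 (inord 2)
              |have := uM0 (inord 3)|have := uM0 (inord 4)|have := uM0 (inord 5)];
  by rewrite uM4 !inordK //= !meval0 !mevalXU !mulr0 ?addr0 ?add0r.
Qed.

(** If the evaluated matrix had rank 4, some four columns would form an invertible minor.
    Conversely, a left kernel vector of the matrix also kills every selection of columns. *)
Lemma minors_kernel q :
  (forall c : 'I_4 -> 'I_6, (\det (colsub c (amat K))).@[q] = 0) <->
  exists2 u : 'I_4 -> K, exists i, u i != 0 & kernel_eqs u q.
Proof.
have detE (c : 'I_4 -> 'I_6) :
    (\det (colsub c (amat K))).@[q] = \det (colsub c (map_mx (meval q) (amat K))).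
  by rewrite -det_map_mx; congr (\det _); apply/matrixP => a b; rewrite !mxE.
split=> [minors0|[u [i ui] /kernel_eqsP uM] c].
  have : kermx (map_mx (meval q) (amat K)) != 0.
    rewrite kermx_eq0 -row_leq_rank -mxrank_tr -ltnNge ltn_neqAle rank_leq_col andbT.
    apply/negP => full; have /(_ full) := @fullrowsub_unit _ _ _ (map_mx (meval q) (amat K))^T.
    rewrite unitmxE unitfE -det_tr; set f := fullrankfun _.
    have -> : (rowsub f (map_mx (meval q) (amat K))^T)^T = colsub f (map_mx (meval q) (amat K)).
      by apply/matrixP => a b; rewrite !mxE.
    by rewrite -detE minors0 eqxx.
  move=> /rowV0Pn [u /sub_kermxP uM u0]; exists (u 0).
    by apply/existsP; apply: contraNT u0 => /existsPn u0; apply/eqP/rowP => i; rewrite mxE;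
       apply/eqP; rewrite -[_ == _]negbK u0.
  by apply/kernel_eqsP; rewrite -[RHS]uM; congr (_ *m _); apply/rowP => i; rewrite mxE.
rewrite detE; apply/eqP; apply: contraTT ui => det0; rewrite negbK.
have unitM : colsub c (map_mx (meval q) (amat K)) \in unitmx by rewrite unitmxE unitfE.
have : (\row_i u i) *m colsub c (map_mx (meval q) (amat K)) = 0.
  apply/rowP => j; have := congr1 (fun M : 'rV_6 => M 0 (c j)) uM; rewrite !mxE => E.
  by rewrite -[RHS]E; apply: eq_bigr => l _; rewrite !mxE.
move/(congr1 (mulmx^~ (invmx (colsub c (map_mx (meval q) (amat K)))))).
by rewrite mulmxK // mul0mx => /rowP /(_ i); rewrite !mxE => ->.
Qed.

Lemma XhypP q : Xhyp q <->
  [/\ nonzero q, quadric_eqs q & exists2 u : 'I_4 -> K, exists i, u i != 0 & kernel_eqs u q].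
Proof.
split=> [[nz [e0 [e1 [e2 [e3 m]]]]]|[nz /quadric_eqsP [e0 [e1 [e2 e3]]] /minors_kernel m]].
  by split=> //; [apply/quadric_eqsP | apply/minors_kernel].
by [].
Qed.

Lemma homog_nth_rowsA i j : nth 0 (nth [::] (rowsA K) i) j \is 1.-homog.
Proof.
have AX k : A K k \is 1.-homog by rewrite dhomogX /= mdeg1.
have Z : (0 : {mpoly K[12]}) \is 1.-homog by apply: dhomog0.
do 4?[case: i => [|i]; first by do 6?[case: j => [|j] //=; try exact: AX]; rewrite nth_nil].
by rewrite /= nth_nil nth_nil.
Qed.

Lemma homog_minor (c : 'I_4 -> 'I_6) : homogeneous (\det (colsub c (amat K))).
Proof.
exists 4%N; apply: rpred_sum => s _; rewrite mulr_sign.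
suff : \prod_i colsub c (amat K) i (s i) \is 4.-homog.
  by case: (odd_perm s); rewrite ?dhomogN.
by apply: dhomog_prod_linear => i; rewrite !mxE homog_nth_rowsA.
Qed.

Lemma homog_quadrics :
  [/\ homogeneous (q0 K), homogeneous (q1 K), homogeneous (q2 K) & homogeneous (q3 K)].
Proof.
have AA i j : A K i * A K j \is 2.-homog.
  by apply: (@dhomogM _ _ _ 1 _ 1); rewrite dhomogX /= mdeg1.
by split; exists 2%N; rewrite !(rpredD, rpredB, rpredN) ?AA.
Qed.

End Equations.

(** * The monomial inverse of [Phi] on the torus *)

Section Inverse.
Variable K : fieldType.

Lemma ord10P (P : 'I_10 -> Prop) : P (inord 0) -> P (inord 1) -> P (inord 2) ->
  P (inord 3) -> P (inord 4) -> P (inord 5) -> P (inord 6) -> P (inord 7) -> P (inord 8) ->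
  P (inord 9) -> forall i, P i.
Proof.
move=> ? ? ? ? ? ? ? ? ? ? i; rewrite -(inord_val i).
by case: i => [[|[|[|[|[|[|[|[|[|[|m]]]]]]]]]] lt].
Qed.

(** On the image of [Phi], quotients of monomials isolate the ratios: a_31/a_21 = - y_0/y_1, and
    similarly for z, x and w. Entry 0 is then adjusted to entry 1 and to the chosen representatives
    of w, on which v_0 depends through its weight t^2. *)
Definition inversePhi (i : 'I_10) : {mpoly K[12]} :=
  match val i with
  | 0 => a23 K * a20 K * a31 K * a12 K * a10 K * a32 K * a21 K
  | 1 => a03 K
  | 2 => a20 K * a31 K * a12 K
  | 3 => a10 K * a32 K * a21 K
  | 4 => a21 K ^+ 2 * a32 K
  | 5 => a12 K ^+ 2 * a31 K
  | 6 => - a31 K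
  | 7 => a21 K
  | 8 => - (a31 K * a12 K)
  | _ => a32 K * a21 K
  end.

Definition Phi_poly (i : 'I_12) : {mpoly K[10]} :=
  let X k : {mpoly K[10]} := 'X_(inord k) in
  let v0 := X 0 in let v1 := X 1 in let w0 := X 2 in let w1 := X 3 in
  let x0 := X 4 in let x1 := X 5 in let y0 := X 6 in let y1 := X 7 in
  let z0 := X 8 in let z1 := X 9 in
  let L := x1 * w1 - x0 * w0 in
  match val i with
  | 0 => - (v0 * v1 * w1 * (w1 + w0) * L * x0 * (x1 + x0) * y1 ^+ 2 * z0 ^+ 2)
  | 1 => v0 * v1 * w0 * (w1 + w0) * L * x1 * (x1 + x0) * y1 ^+ 2 * z1 ^+ 2
  | 2 => - (v0 * v1 * w0 * w1 * L * x0 * x1 * y0 ^+ 2 * z1 ^+ 2)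
  | 3 => - (v1 ^+ 2 * w0 * w1 ^+ 2 * (w1 + w0) ^+ 2 * x0 * x1 * (x1 + x0)
              * y1 ^+ 2 * z0 * z1)
  | 4 => v0 ^+ 2 * L * x1 * (x1 + x0) * y1 ^+ 2 * z0 * z1
  | 5 => - (v0 ^+ 2 * L * x0 * x1 * y0 ^+ 2 * z0 * z1)
  | 6 => v1 ^+ 2 * w0 ^+ 2 * w1 * (w1 + w0) ^+ 2 * x0 * x1 * (x1 + x0)
           * y1 ^+ 2 * z1 ^+ 2
  | 7 => - (v0 ^+ 2 * L * x0 * (x1 + x0) * y1 ^+ 2 * z0 ^+ 2)
  | 8 => - (v0 ^+ 2 * L * x0 * x1 * y0 ^+ 2 * z1 ^+ 2)
  | 9 => - (v1 ^+ 2 * w0 ^+ 2 * w1 ^+ 2 * (w1 + w0) * x0 * x1 * (x1 + x0)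
              * y0 * y1 * z1 ^+ 2)
  | 10 => v0 ^+ 2 * L * x0 * (x1 + x0) * y0 * y1 * z0 ^+ 2
  | _ => v0 ^+ 2 * L * x1 * (x1 + x0) * y0 * y1 * z1 ^+ 2
  end.

(** The Cox coordinates times the three factors of [Phi] which are not monomials. *)
Definition torus_poly : {mpoly K[10]} :=
  let X k : {mpoly K[10]} := 'X_(inord k) in
  X 0 * X 1 * X 2 * X 3 * X 4 * X 5 * X 6 * X 7 * X 8 * X 9
  * (X 3 + X 2) * (X 5 + X 4) * (X 5 * X 3 - X 4 * X 2).

Lemma meval_Phi_poly p i : (Phi_poly i).@[p] = Phi p i.
Proof.
by case: i => [[|[|[|[|[|[|[|[|[|[|[|[|i]]]]]]]]]]]] lt] //;
  rewrite /Phi_poly /Phi /= !(mevalN, mevalM, mevalD, mevalB, mevalXU, rmorphXn) /= ?mevalXU.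
Qed.

Definition torus n (q : pt K n) := forall i, q i != 0.

Lemma torus_polyP p : torus_poly.@[p] != 0 -> [/\ torus p, p#3 + p#2 != 0, p#5 + p#4 != 0 &
  p#5 * p#3 - p#4 * p#2 != 0].
Proof.
rewrite /torus_poly !(mevalM, mevalD, mevalN, mevalXU) !mulf_eq0 !negb_or -!andbA.
do 12![move=> /andP [?]]; move=> ?.
by split=> // i; elim/ord10P: i.
Qed.

Lemma evalPsiE q : [/\ [/\ (evalPsi inversePhi q)#0 = q#8 * q#6 * q#10 * q#4 * q#3 * q#11 * q#7,
   (evalPsi inversePhi q)#1 = q#2, (evalPsi inversePhi q)#2 = q#6 * q#10 * q#4,
   (evalPsi inversePhi q)#3 = q#3 * q#11 * q#7 & (evalPsi inversePhi q)#4 = q#7 ^+ 2 * q#11],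
   (evalPsi inversePhi q)#5 = q#4 ^+ 2 * q#10 & [/\
   (evalPsi inversePhi q)#6 = - q#10, (evalPsi inversePhi q)#7 = q#7,
   (evalPsi inversePhi q)#8 = - (q#10 * q#4) & (evalPsi inversePhi q)#9 = q#11 * q#7]].
Proof.
by split; [split| |split]; rewrite /evalPsi /inversePhi /= inordK //
  !(mevalN, mevalM, mevalXU, rmorphXn) /= ?mevalXU.
Qed.

Lemma torus_Phi p : torus_poly.@[p] != 0 -> torus (Phi p).
Proof.
move=> /torus_polyP [tp w x L] i; elim/ord12P: i; rewrite /Phi /= inordK //;
by rewrite ?oppr_eq0 !(mulf_neq0, expf_neq0) ?tp.
Qed.

Lemma relevant_torus p : torus p -> relevant p.
Proof. by move=> tp; do !split; left; apply/eqP/tp. Qed.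

Lemma inversePhiK p : torus_poly.@[p] != 0 -> sequiv p (evalPsi inversePhi (Phi p)).
Proof.
move=> hp; have [tp w x L] := torus_polyP hp; split; first exact: relevant_torus.
have tPhi := torus_Phi hp.
have [[e0 e1 e2 e3 e4] e5 [e6 e7 e8 e9]] := evalPsiE (Phi p).
(* The five scaling factors are read off at v_1, w_1, x_1, y_1 and z_1. *)
exists ((Phi p)#2 / p#1), ((Phi p)#3 * (Phi p)#11 * (Phi p)#7 / p#3),
  ((Phi p)#4 ^+ 2 * (Phi p)#10 / p#5), ((Phi p)#7 / p#7), ((Phi p)#11 * (Phi p)#7 / p#9).
do 5?[split; first by apply/eqP; rewrite !(mulf_neq0, expf_neq0) ?invr_eq0 ?tPhi ?tp].
apply: functional_extensionality => i; elim/ord10P: i;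
rewrite ?(e0, e1, e2, e3, e4, e5, e6, e7, e8, e9) /tact /= !inordK // /Phi /= !inordK //;
move: (tp (inord 0)) (tp (inord 1)) (tp (inord 2)) (tp (inord 3)) (tp (inord 4))
  (tp (inord 5)) (tp (inord 6)) (tp (inord 7)) (tp (inord 8)) (tp (inord 9)) w x L;
move: (p#0) (p#1) (p#2) (p#3) (p#4) (p#5) (p#6) (p#7) (p#8) (p#9).
all: move=> v0 v1 w0 w1 x0 x1 y0 y1 z0 z1 *.
(* The identities are monomial in these three factors too, so the factors may become free
   variables. *)
all: move: {+}(x1 * w1 - x0 * w0) {+}(w1 + w0) {+}(x1 + x0).
all: by move=> L' W' X'; field; do ?[apply/andP; split].
Qed.

Lemma inversePhi_scale q (l : K) : torus q -> l != 0 ->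
  sequiv (evalPsi inversePhi q) (evalPsi inversePhi (pscale l q)).
Proof.
move=> tq l0.
have [[e0 e1 e2 e3 e4] e5 [e6 e7 e8 e9]] := evalPsiE q.
have [[f0 f1 f2 f3 f4] f5 [f6 f7 f8 f9]] := evalPsiE (pscale l q).
split.
  apply: relevant_torus => i; elim/ord10P: i;
  by rewrite ?(e0, e1, e2, e3, e4, e5, e6, e7, e8, e9) ?oppr_eq0 ?(mulf_neq0, expf_neq0) ?tq.
(* These are the degrees of the entries of [inversePhi] at v_1, w, x, y and z; entry 0 has degree 7
   = 1 + 2 * 3, matching the weight s t^2. *)
exists l, (l ^+ 3), (l ^+ 3), l, (l ^+ 2).
do 5?[split; first by apply/eqP; rewrite ?expf_neq0].
apply: functional_extensionality => i; elim/ord10P: i; rewrite /tact /= inordK //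
 ?(f0, f1, f2, f3, f4, f5, f6, f7, f8, f9) ?(e0, e1, e2, e3, e4, e5, e6, e7, e8, e9) /pscale; ring.
Qed.

Lemma kernel_torus (u : 'I_4 -> K) q : torus q -> kernel_eqs u q ->
  (exists i, u i != 0) -> torus u.
Proof.
move=> tq [[k01 k02 k12] [k03 k13 k23]] [i ui].
have tr (a b x y : K) : x != 0 -> y != 0 -> a * x + b * y = 0 -> (a == 0) = (b == 0).
  move=> x0 y0 E; apply/eqP/eqP => E0; move/eqP: E; rewrite E0 mul0r ?add0r ?addr0.
    by rewrite mulf_eq0 (negPf y0) orbF => /eqP.
  by rewrite mulf_eq0 (negPf x0) orbF => /eqP.
have e1 := tr _ _ _ _ (tq _) (tq _) k01.
have e2 := tr _ _ _ _ (tq _) (tq _) k02.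
have e3 := tr _ _ _ _ (tq _) (tq _) k03.
have eu0 j : (u j == 0) = (u#0 == 0) by elim/ord4P: j.
by move=> j; rewrite eu0 -(eu0 i).
Qed.

(** The kernel vector eliminates every a_ji with i < j, and the quadrics turn L, x_1 + x_0 and w_1 +
    w_0 at the inverse point into monomials. Then all twelve equations compare monomials. *)
Lemma PhiK q : Xhyp q -> torus q ->
  exists2 l : K, l != 0 & forall i, Phi (evalPsi inversePhi q) i = l * q i.
Proof.
move=> /XhypP [_ [Q0 Q1 Q2 Q3] [u nzu ku]] tq; have tu := kernel_torus tq ku nzu.
have [[e0 e1 e2 e3 e4] e5 [e6 e7 e8 e9]] := evalPsiE q.
have [[k01 k02 k12] [k03 k13 k23]] := ku.
have solve (a b x y : K) : b != 0 -> a * x + b * y = 0 -> y = - (a * x) / b.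
  by move=> b0 E; have -> : y = (a * x + b * y) / b - (a * x) / b; [field | rewrite E; field].
have s10 := solve _ _ _ _ (tu _) k01; have s20 := solve _ _ _ _ (tu _) k02.
have s21 := solve _ _ _ _ (tu _) k12; have s30 := solve _ _ _ _ (tu _) k03.
have s31 := solve _ _ _ _ (tu _) k13; have s32 := solve _ _ _ _ (tu _) k23.
move: (tu (inord 0)) (tu (inord 1)) (tu (inord 2)) (tu (inord 3)) => u0n u1n u2n u3n.
move: (tq (inord 0)) (tq (inord 1)) (tq (inord 2)) (tq (inord 4)) (tq (inord 5)) (tq (inord 8))
  => a01n a02n a03n a12n a13n a23n.
(* In the next three identities the difference of the two sides is an explicit combination
   of the quadrics. *)
have HL : q#4 ^+ 2 * q#10 * (q#3 * q#11 * q#7) - q#7 ^+ 2 * q#11 * (q#6 * q#10 * q#4)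
    = q#4 * q#7 * q#10 * q#11 * q#0 * q#1.
  apply/eqP; rewrite -subr_eq0; apply/eqP; transitivity (- (q#4 * q#7 * q#10 * q#11) *
    (q#0 * q#1 - q#3 * q#4 + q#6 * q#7)); [ring | by rewrite Q3 mulr0].
have HX : q#4 ^+ 2 * q#10 + q#7 ^+ 2 * q#11
    = u#1 ^+ 2 * u#2 * q#4 * q#5 * q#8 / u#3 ^+ 3.
  apply/eqP; rewrite -subr_eq0; apply/eqP; transitivity (- (u#1 * q#4 / u#3) *
    (q#4 * q#5 - q#7 * q#8 + q#10 * q#11)); last by rewrite Q0 mulr0.
  rewrite s31 s21 s32; field; by rewrite ?u2n ?u3n.
have HW : q#3 * q#11 * q#7 + q#6 * q#10 * q#4
    = - (u#0 * q#0 * q#1 * q#5 * q#8) / (u#3 * q#2).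
  apply/eqP; rewrite -subr_eq0; apply/eqP; transitivity (u#0 / (u#2 * u#3 * q#2) *
    (u#2 * q#8 * (q#4 * (q#3 * q#5 - q#0 * q#2 + q#9 * q#10)
      + q#5 * (q#0 * q#1 - q#3 * q#4 + q#6 * q#7))
     + u#1 * q#4 * q#5 * (q#1 * q#2 - q#9 * q#11 + q#6 * q#8)));
    last by rewrite Q1 Q2 Q3; ring.
  rewrite s10 s20 s30 s31 s21 s32; field; by rewrite ?u1n ?u2n ?u3n.
(* The factor is read off at the coordinate a_32. *)
exists ((Phi (evalPsi inversePhi q))#11 / q#11).
  rewrite /Phi /= inordK // e0 e3 e2 e4 e5 e6 e7 e9 HL HX.
  by rewrite !(mulf_neq0, expf_neq0) ?oppr_eq0 ?invr_eq0 ?expf_neq0 ?tq.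
move=> i; elim/ord12P: i; rewrite /Phi /= !inordK // e0 ?e1 ?e3 ?e2 ?e4 e5 ?e6 ?e7 ?e8 ?e9
  HL HX ?HW;
 rewrite ?s10 ?s20 ?s30 ?s31 ?s21 ?s32; field; by rewrite ?oppr_eq0 ?mulf_neq0 ?u0n ?u1n ?u2n ?u3n.
Qed.

End Inverse.

(** * The closure of the image of [Phi], and components meeting the torus *)

Section ImageClosure.
Variable K : closedFieldType.
Implicit Types (f g : {mpoly K[12]}) (p : pt K 10) (q v : pt K 12).

Definition pullback f : {mpoly K[10]} := f \mPo [tuple Phi_poly K i | i < 12].

Lemma meval_pullback f p : (pullback f).@[p] = f.@[Phi p].
Proof.
rewrite comp_mpoly_meval; apply: meval_eq => i.
by rewrite tnth_mktuple meval_Phi_poly.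
Qed.

(** Forms are tested only where [torus_poly] is nonzero, so that the image points lie on the torus;
    by [vanish_Phi] the closure still contains every defined value of [Phi]. *)
Definition image_closure : pset K 12 := fun v => nonzero v /\
  forall f, homogeneous f -> (forall p, (torus_poly K).@[p] != 0 -> f.@[Phi p] = 0) -> f.@[v] = 0.

Definition coord_prod : {mpoly K[12]} := \prod_(i < 12) 'X_i.

Lemma meval_coord_prod q : (coord_prod.@[q] != 0) <-> torus q.
Proof.
rewrite /coord_prod rmorph_prod /=.
split=> [/prodf_neq0 H i|tq]; first by have := H i isT; rewrite mevalXU.
by apply/prodf_neq0 => i _; rewrite mevalXU tq.
Qed.

Lemma homogeneous_coord_prod : homogeneous coord_prod.
Proof.
by exists 12; apply: dhomog_prod_linear => i; rewrite dhomogX /= mdeg1.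
Qed.

Lemma torus_nonzero q : torus q -> nonzero q.
Proof. by move=> tq; exists ord0; apply/eqP. Qed.

Lemma torus_poly_neq0 : [pchar K] =i pred0 -> torus_poly K != 0.
Proof.
move=> char0; have natn0 n : n.+1%:R != 0 :> K by rewrite (proj1 (pcharf0P K) char0).
(* At w_1 = 2 and all other coordinates 1, the three special factors are w_1 + w_0 = 3, x_1 + x_0 =
   2 and L = 1. *)
apply/eqP => /(congr1 (meval (fun i => if i == inord 3 then 2 else 1))) /eqP.
rewrite meval0 /torus_poly !(mevalM, mevalD, mevalN, mevalXU) -!val_eqE /= !inordK //=.
have -> : 1 * 2 - 1 * 1 = 1 :> K by ring.
have -> : 2 + 1 = 3%:R :> K by ring.
have -> : 1 + 1 = 2%:R :> K by ring.
by rewrite !(mul1r, mulr1) !mulf_eq0 !(negPf (natn0 _)).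
Qed.

Hypothesis torus_poly0 : torus_poly K != 0.

(** The pullback times [torus_poly] vanishes at every point, hence is the zero polynomial, and
    [torus_poly] can be cancelled. *)
Lemma vanish_Phi f : (forall p, (torus_poly K).@[p] != 0 -> f.@[Phi p] = 0) ->
  forall p, f.@[Phi p] = 0.
Proof.
move=> H; suff F0 : pullback f = 0 by move=> p; rewrite -meval_pullback F0 meval0.
apply: (mulIf torus_poly0); rewrite mul0r; apply/eqP/negPn/negP => /mpoly_nonroot [p].
rewrite mevalM mulf_eq0 negb_or meval_pullback => /andP [fp tp].
by rewrite H ?eqxx in fp.
Qed.

Lemma image_closure_Phi p : nonzero (Phi p) -> image_closure (Phi p).
Proof. by move=> nz; split=> // f _ /vanish_Phi. Qed.

(** Forms that separate a point of the closure from A and from B have nonzero pullbacks. Their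
    product with [torus_poly] is nonzero at some p, whose image then lies neither in A nor in B. *)
Lemma irreducible_image_closure : irreducible image_closure.
Proof.
split; [|split].
- exists (fun f => homogeneous f /\ forall p, (torus_poly K).@[p] != 0 -> f.@[Phi p] = 0).
  split=> [f []//|v]; split=> -[nz H]; split=> // f; first by case; apply: H.
  by move=> hf f0; apply: H.
- have [p tp] := mpoly_nonroot torus_poly0.
  by exists (Phi p); apply/image_closure_Phi/torus_nonzero/torus_Phi.
move=> A B clA clB WAB; apply: NNPP => /not_or_and [nA nB].
have sep C : proj_closed C -> ~ psubset image_closure C ->
    exists2 f, forall w, C w -> f.@[w] = 0 & pullback f != 0.
  move=> clC nC; have [v Wv nCv] : exists2 v, image_closure v & ~ C v.
    by apply: NNPP => H; apply: nC => v Wv; apply: NNPP => nCv; apply: H; exists v.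
  have [d [f [_ fd fC fv]]] := proj_closed_separating clC Wv.1 nCv.
  exists f => //; apply: contraNneq fv => f0; apply/eqP/Wv.2; first by exists d.
  by move=> p _; rewrite -meval_pullback f0 meval0.
have [f fA f0] := sep A clA nA; have [g gB g0] := sep B clB nB.
have [p] := mpoly_nonroot (mulf_neq0 torus_poly0 (mulf_neq0 f0 g0)).
rewrite mevalM mulf_eq0 negb_or => /andP [tp].
rewrite mevalM mulf_eq0 negb_or !meval_pullback => /andP [fp gp].
have [/fA E|/gB E] := WAB _ (image_closure_Phi (torus_nonzero (torus_Phi tp))).
  by rewrite E eqxx in fp.
by rewrite E eqxx in gp.
Qed.

Lemma Xhyp_Phi p : (torus_poly K).@[p] != 0 -> Xhyp (Phi p).
Proof.
move=> hp; have [tp w x L] := torus_polyP hp; apply/XhypP; split.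
- exact/torus_nonzero/torus_Phi.
- by rewrite /quadric_eqs /Phi /= !inordK //=; split; ring.
(* The kernel vector solves u_i/u_j = - a_ji/a_ij on the image, with denominators cleared. *)
pose u0 := p#1 * p#2 * p#3 * (p#3 + p#2) * p#4 * p#5 * p#9 * (p#5 + p#4) * p#7.
pose c := - (p#0 * (p#5 * p#3 - p#4 * p#2)).
exists (fun i => nth 0 [:: u0; c * p#8 * p#4 * (p#5 + p#4) * p#7;
  c * p#5 * p#9 * (p#5 + p#4) * p#7; c * p#6 * p#4 * p#5 * p#9] i).
  by exists (inord 0); rewrite inordK //= /u0 !mulf_neq0 ?tp.
by rewrite /kernel_eqs /Phi /u0 /c /= !inordK //=; split; split; ring.
Qed.

Lemma image_closure_sub : psubset image_closure (@Xhyp K).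
Proof.
move=> v [nz H]; have [h0 h1 h2 h3] := homog_quadrics K.
have VX f : homogeneous f -> (forall p, Xhyp (Phi p) -> f.@[Phi p] = 0) -> f.@[v] = 0.
  by move=> hf Hf; apply: H => // p /Xhyp_Phi /Hf.
split=> //; do 4?[split; first by apply: VX => // p [_ [? [? [? []]]]]].
by move=> c; apply: VX; [apply: homog_minor | move=> p [_ [_ [_ [_ []]]]]].
Qed.

(** Let f vanish on the image. Torus points of [V] are image points up to scaling, so f times the
    product of the coordinates vanishes on [V]; irreducibility and the point [q] leave f = 0 on [V].
    Maximality of [V] gives the other inclusion. *)
Lemma component_image_closure (V : pset K 12) q : irr_component (@Xhyp K) V ->
  V q -> torus q -> forall v, V v <-> image_closure v.
Proof.
move=> [irrV [VX maxV]] Vq tq.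
have VW : psubset V image_closure.
  move=> v Vv; split=> [|f hf /vanish_Phi f0]; first exact: irreducible_nonzero Vv.
  have [|/(_ v Vv) //|/(_ q Vq) E] := irreducible_mulf irrV hf homogeneous_coord_prod.
    move=> w Vw; have [->|/meval_coord_prod tw] := eqVneq (coord_prod.@[w]) 0.
      by rewrite mulr0.
    have [l l0 E] := PhiK (VX _ Vw) tw; have [d fd] := hf.
    have := f0 (evalPsi (inversePhi K) w).
    rewrite (meval_scale_eq fd (fun i => esym (E i))) => /eqP.
    by rewrite mulf_eq0 expf_eq0 (negPf l0) andbF => /eqP ->; rewrite mul0r.
  by have /eqP := proj2 (meval_coord_prod q) tq.
move=> v; split; first exact: VW.
exact: (maxV _ irreducible_image_closure VW image_closure_sub).
Qed.

End ImageClosure.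

(** * Classification of the points of [Xhyp] off the torus *)

Ltac up_to_sign E := first [solve [apply: (etrans _ E); ring] |
  solve [apply: oppr_inj; rewrite oppr0; apply: (etrans _ E); ring]].

Section Degenerate.
Variable K : fieldType.
Implicit Types (b : 'I_4 -> 'I_4 -> K) (u : 'I_4 -> K).

(* The entries a_ij of amat, up to the signs which make all the equations symmetric
   under permutations of the four indices. *)
Definition edge (i j : 'I_4) : 'I_12 := inord (nth 0
  (nth [::] [:: [:: 0; 0; 1; 2]; [:: 3; 0; 4; 5]; [:: 6; 7; 0; 8]; [:: 9; 10; 11; 0]] i) j)%N.
Definition edge_ends (k : 'I_12) : 'I_4 * 'I_4 :=
  (inord (nth 0 [:: 0; 0; 0; 1; 1; 1; 2; 2; 2; 3; 3; 3] k)%N,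
   inord (nth 0 [:: 1; 2; 3; 0; 2; 3; 0; 1; 3; 0; 1; 2] k)%N).
(** The sign is negative exactly for a_02, a_20, a_13 and a_31. *)
Definition edge_sign (i j : 'I_4) : K :=
  if ((i == j + 2 :> nat) || (j == i + 2 :> nat))%N then - 1 else 1.
Definition edge_val (q : pt K 12) i j := if i == j then 0 else edge_sign i j * q (edge i j).

Definition symmetric_eqs u b :=
  [/\ forall i, b i i = 0, forall i j, i != j -> u i * b i j + u j * b j i = 0
    & forall i j k, i != j -> i != k -> j != k ->
        b i j * b i k + b j i * b j k + b k i * b k j = 0].

(** Every ordered pair or triple of distinct indices reproduces one of the original equations up to
    sign, so all later cases may be relabelled freely. *)
Lemma symmetric_eqs_edge_val u q : quadric_eqs q -> kernel_eqs u q ->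
  symmetric_eqs u (edge_val q).
Proof.
move=> [Q0 Q1 Q2 Q3] [[k01 k02 k12] [k03 k13 k23]]; split.
- by move=> i; rewrite /edge_val eqxx.
- move=> i j; rewrite /edge_val /edge_sign /edge -!val_eqE.
  elim/ord4P: i; elim/ord4P: j; rewrite /= !inordK //= => _;
  first [up_to_sign k01 | up_to_sign k02 | up_to_sign k12 | up_to_sign k03 | up_to_sign k13
    | up_to_sign k23].
- move=> i j k; rewrite /edge_val /edge_sign /edge -!val_eqE.
  elim/ord4P: i; elim/ord4P: j; rewrite /= !inordK //= => _;
  elim/ord4P: k; rewrite /= !inordK //= => _ _;
  first [up_to_sign Q0 | up_to_sign Q1 | up_to_sign Q2 | up_to_sign Q3].
Qed.

Lemma edge_val_ends q k : q k = edge_sign (edge_ends k).1 (edge_ends k).2 *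
  edge_val q (edge_ends k).1 (edge_ends k).2.
Proof.
by elim/ord12P: k; rewrite /edge_val /edge_sign /edge_ends /edge -!val_eqE /= !inordK //= ?mulN1r
  ?mul1r ?opprK.
Qed.

(* The strata off the torus which are not in a 5-dimensional coordinate subspace, as matrices of
   edge values up to relabelling and scaling: an isolated index with one quadric left, then
   kernel vectors u with one, two and three zero entries. The factors M and N clear the
   denominators which arise from solving the last equation. *)
Definition strata : seq (seq (seq {mpoly K[4]})) :=
  let X k : {mpoly K[4]} := 'X_(inord k) in
  let M := X 0 * (1 - X 1 * X 2) in
  let N := X 1 * X 3 + X 0 * X 2 in
  [:: [:: [:: 0; 0; 0; 0];
          [:: 0; 0; - (X 0 * X 1 + X 2 * X 3); 1];
          [:: 0; X 0; 0; X 1];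
          [:: 0; X 2; X 3; 0]];
      [:: [:: 0; X 3; 0; 0];
          [:: 0; 0; X 1 * M; X 2 * M];
          [:: 0; - (X 0 * M); 0; X 1 * X 2];
          [:: 0; - (X 0 * X 2 * M); - (X 1 * X 1 * X 2); 0]];
      [:: [:: 0; X 0; X 1; 0];
          [:: - (X 0 * X 1); 0; 1; 0];
          [:: 0; 0; 0; X 2];
          [:: 0; 0; X 3; 0]];
      [:: [:: 0; X 0 * X 3 * N; - (X 1 * X 2 * N); N];
          [:: - (X 3 * N); 0; - (X 0 * X 1 * X 1 * X 2 * X 3); X 0 * N];
          [:: X 2 * N; X 0 * X 0 * X 1 * X 2 * X 3; 0; X 1 * N];
          [:: 0; 0; 0; 0]]].

Definition stratum_entry m x y : {mpoly K[4]} := nth 0 (nth [::] (nth [::] strata m) x) y.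

Definition in_stratum b := exists (s : 4.-tuple 'I_4) (m : 'I_4) (c : K) (t : 'I_4 -> K),
  [/\ uniq s, c != 0 & forall x y, (x < 4)%N -> (y < 4)%N ->
    c * b (nth ord0 s x) (nth ord0 s y) = (stratum_entry m x y).@[t]].

(** Five entries span a coordinate subspace of projective dimension 4. *)
Definition small_support b := (exists i j, b i j <> 0) /\
  exists2 s : seq ('I_4 * 'I_4), (size s <= 5)%N & forall i j, b i j != 0 -> (i, j) \in s.

Lemma uniq4_mem (i j k l : 'I_4) : uniq [:: i; j; k; l] -> forall x, x \in [:: i; j; k; l].
Proof.
move=> u4 x; have sub : {subset [:: i; j; k; l] <= enum 'I_4}.
  by move=> y _; rewrite mem_enum.
have [|_ ->] := uniq_min_size u4 sub; first by rewrite size_enum_ord.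
by rewrite mem_enum.
Qed.

Lemma uniq4_cases (i j k l : 'I_4) : uniq [:: i; j; k; l] ->
  forall x, [\/ x = i, x = j, x = k | x = l].
Proof.
move=> u4 x; have := uniq4_mem u4 x; rewrite !inE.
by case/or4P => /eqP ->; [constructor 1 | constructor 2 | constructor 3 | constructor 4].
Qed.

Lemma covered_strata : covered 4 (fun v : 'I_4 * 'I_4 -> K =>
  small_support (fun i j => v (i, j)) \/ in_stratum (fun i j => v (i, j))).
Proof.
apply: covered_or.
  apply: covered_sub (@covered_support K ('I_4 * 'I_4)%type 4) => v [[i [j vij]] [s szs sP]].
  by split; [exists (i, j) | exists s => // -[]].
exists (4.-tuple 'I_4 * 'I_4)%type, (fun (sm : 4.-tuple 'I_4 * 'I_4) (p : 'I_4 * 'I_4) =>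
  stratum_entry sm.2 (index p.1 sm.1) (index p.2 sm.1)).
move=> v [s [m [c [t [us c0 E]]]]]; exists (s, m), c, t; split=> // -[i j] /=.
have ins x : x \in s.
  case: s us {E} => [[|a [|b [|d [|e [|f s]]]]] //= sz] us.
  exact: (@uniq4_mem a b d e).
have lt4 x : (index x s < 4)%N by have := ins x; rewrite -index_mem size_tuple.
by rewrite -E // !nth_index.
Qed.

Section Classification.
Variables (u : 'I_4 -> K) (b : 'I_4 -> 'I_4 -> K).
Hypotheses (ub : symmetric_eqs u b) (b0 : exists i j, b i j <> 0).
Local Notation goal := (small_support b \/ in_stratum b).

Ltac uniq4_facts H := move: (H); rewrite /= !inE !negb_or !andbT -!andbA
  => /and5P [nij nik nil njk /andP [njl nkl]].
Ltac uniq4_perm H := move: (H); rewrite /= !inE !negb_or !andbT -!andbA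
  => /and5P [? ? ? ? /andP [? ?]];
  repeat (apply/andP; split); first [assumption | rewrite eq_sym; assumption].

(** [s] lists the entries that may be nonzero; every other one is diagonal or vanishes by a
    hypothesis in the context. *)
Ltac by_support H s := left; split; [exact: b0 | exists s => //];
  let x := fresh in let y := fresh in
  move=> x y; case: (uniq4_cases H x) => ->; case: (uniq4_cases H y) => ->;
  rewrite !inE ?xpair_eqE ?eqxx ?andbT ?andTb ?orbT //;
  first [ by rewrite (let: And3 d _ _ := ub in d) eqxx
        | match goal with E : b ?x ?y = 0 |- is_true (b ?x ?y != 0) -> _ => by rewrite E eqxx end ].

Lemma diag_eq0 i : b i i = 0.
Proof. by case: ub. Qed.

Lemma kernel_zero i j : u i = 0 -> u j != 0 -> b j i = 0.
Proof.
have [-> -> /eqP //|nij] := eqVneq i j.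
case: ub => _ k _ ui uj; have /eqP := k _ _ nij; rewrite ui mul0r add0r.
by rewrite mulf_eq0 (negPf uj) => /eqP.
Qed.

Lemma edge_sym0 i j : u j != 0 -> b i j = 0 -> b j i = 0.
Proof.
have [-> //|nij] := eqVneq i j.
case: ub => _ k _ uj bij; have /eqP := k _ _ nij; rewrite bij mulr0 add0r.
by rewrite mulf_eq0 (negPf uj) => /eqP.
Qed.

Lemma mulf0 (x y : K) : x * y = 0 -> x = 0 \/ y = 0.
Proof. by move/eqP; rewrite mulf_eq0 => /orP [] /eqP; [left|right]. Qed.

Lemma triangle_eq i j k : i != j -> i != k -> j != k ->
  b i j * b i k + b j i * b j k + b k i * b k j = 0.
Proof. by case: ub => _ _; apply. Qed.

(** Six entries on the triangle jkl remain, with one quadric. If b_jl is nonzero it is scaled to 1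
    and the quadric gives b_jk; otherwise five entries are left. *)
Lemma isolated_vertex i j k l : uniq [:: i; j; k; l] ->
  b i j = 0 -> b i k = 0 -> b i l = 0 -> b j i = 0 -> b k i = 0 -> b l i = 0 -> goal.
Proof.
move=> u4 ij ik il ji ki li.
have [jl|jl] := eqVneq (b j l) 0.
  by_support u4 [:: (j, k); (k, j); (k, l); (l, j); (l, k)].
right; exists [tuple i; j; k; l], (inord 0), (b j l)^-1,
  (fun x => nth 0 [:: b k j / b j l; b k l / b j l; b l j / b j l; b l k / b j l] x).
split=> //; first by rewrite invr_eq0.
have T : b j k * b j l + b k j * b k l + b l j * b l k = 0.
  by uniq4_facts u4; apply: triangle_eq.
have jkE : b j k = - (b k j * b k l + b l j * b l k) / b j l.
  by apply: (mulIf jl); rewrite divfK //; apply/eqP; rewrite -subr_eq0 opprK addrA; apply/eqP.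
move=> x y; rewrite /stratum_entry inordK //.
case: x => [|[|[|[|//]]]]; case: y => [|[|[|[|//]]]] _ _ /=;
rewrite !(mevalM, mevalD, mevalN, mevalXU, meval0, meval1) ?inordK //=
  ?diag_eq0 ?ij ?ik ?il ?ji ?ki ?li ?jkE; by field.
Qed.

Let sum0 := (mul0r, mulr0, add0r, addr0, mulrN, mulNr).

Lemma classify_full_sub i j k l : uniq [:: i; j; k; l] -> torus u ->
  b i j = 0 -> b i k = 0 -> b l i = 0 \/ b l j = 0 -> goal.
Proof.
move=> u4 tu ij ik; uniq4_facts u4.
have ji := edge_sym0 (tu j) ij; have ki := edge_sym0 (tu k) ik.
case=> [li|lj].
  have il := edge_sym0 (tu i) li; exact: isolated_vertex u4 _ _ _ _ _ _.
have jl := edge_sym0 (tu j) lj.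
have := triangle_eq njk njl nkl; rewrite jl lj !sum0 => /mulf0 [kj|kl].
  have jk := edge_sym0 (tu j) kj; by_support u4 [:: (i, l); (l, i); (k, l); (l, k)].
have lk := edge_sym0 (tu l) kl; by_support u4 [:: (i, l); (l, i); (j, k); (k, j)].
Qed.

(** Without zeros in [u], b_ij and b_ji vanish together. If they do, the triples ijk and ijl each
    force another edge to vanish, one at k and one at l. Either a vertex becomes isolated or, with
    one more triple, two edges remain. *)
Lemma classify_full i j k l : uniq [:: i; j; k; l] -> torus u -> b i j = 0 -> goal.
Proof.
move=> u4 tu ij; uniq4_facts u4; have ji := edge_sym0 (tu j) ij.
have := triangle_eq nij nil njl; rewrite ij ji !sum0 => /mulf0 Tl.
have := triangle_eq nij nik njk; rewrite ij ji !sum0 => /mulf0 [ki|kj].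
  exact: classify_full_sub u4 tu ij (edge_sym0 (tu i) ki) Tl.
have u4' : uniq [:: j; i; k; l] by uniq4_perm u4.
apply: classify_full_sub u4' tu ji (edge_sym0 (tu j) kj) _.
by case: Tl; [right|left].
Qed.

(** Only b_ij and the triangle jkl remain. The kernel equations express the triangle through b_jk,
    b_jl and b_kl, and the quadric determines b_kl in the generic case. *)
Lemma classify_kernel3_sub i j k l : uniq [:: i; j; k; l] ->
  u i = 0 -> u j != 0 -> u k != 0 -> u l != 0 -> b i k = 0 -> b i l = 0 -> goal.
Proof.
move=> u4 ui uj uk ul ik il; uniq4_facts u4.
have ji := kernel_zero ui uj; have ki := kernel_zero ui uk; have li := kernel_zero ui ul.
have T := triangle_eq njk njl nkl.
have [jk|jk] := eqVneq (b j k) 0.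
  have kj := edge_sym0 uk jk; move: T; rewrite jk kj !sum0 => /mulf0 [lj|lk].
    have jl := edge_sym0 uj lj; by_support u4 [:: (i, j); (k, l); (l, k)].
  have kl := edge_sym0 uk lk; by_support u4 [:: (i, j); (j, l); (l, j)].
have [_ kern _] := ub.
have kjE : b k j = - (u j * b j k) / u k.
  apply: (mulIf uk); rewrite divfK //; apply/eqP; rewrite -subr_eq0; apply/eqP.
  by apply: (etrans _ (kern _ _ njk)); ring.
have ljE : b l j = - (u j * b j l) / u l.
  apply: (mulIf ul); rewrite divfK //; apply/eqP; rewrite -subr_eq0; apply/eqP.
  by apply: (etrans _ (kern _ _ njl)); ring.
have lkE : b l k = - (u k * b k l) / u l.
  apply: (mulIf ul); rewrite divfK //; apply/eqP; rewrite -subr_eq0; apply/eqP.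
  by apply: (etrans _ (kern _ _ nkl)); ring.
have {}T : b j k * b j l - u j * b j k * b k l / u k + u j * u k * b j l * b k l / u l ^+ 2 = 0.
  by rewrite -[RHS]T kjE ljE lkE; field; rewrite uk ul.
have [jl|jl] := eqVneq (b j l) 0.
  have lj := edge_sym0 ul jl; move: T; rewrite jl !sum0 => /eqP.
  rewrite oppr_eq0 !mulf_eq0 invr_eq0 (negPf uj) (negPf uk) (negPf jk) orbF /= => /eqP kl.
  have lk := edge_sym0 ul kl; by_support u4 [:: (i, j); (j, k); (k, j)].
pose A := u j / u l; pose B := u k / u l; pose C := b j l * u k / (u l * b j k).
(* The quadric reads b_jk b_jl = u_j b_jk b_kl (1 - B C) / u_k, so solving for b_kl divides by 1 - B
   C; this factor is nonzero because the left-hand side is. *)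
pose M := A * (1 - B * C).
have M0 : M != 0.
  rewrite mulf_neq0 ?mulf_neq0 ?invr_eq0 //; apply/eqP => BC.
  suff /eqP : b j k * b j l = 0 by rewrite mulf_eq0 (negPf jk) (negPf jl).
  rewrite -[RHS]T; apply/eqP; rewrite -subr_eq0; apply/eqP.
  transitivity (u j * b j k * b k l / u k * (1 - B * C)); last by rewrite BC mulr0.
  by rewrite /B /C; field; rewrite uk ul jk.
pose c := M * u k / (u l * b j k).
right; exists [tuple i; j; k; l], (inord 1), c, (fun x => nth 0 [:: A; B; C; c * b i j] x).
split=> //; first by apply: mulf_neq0; rewrite ?invr_eq0; apply: mulf_neq0.
have klE : c * b k l = B * C.
  apply/eqP; rewrite -subr_eq0; apply/eqP.
  transitivity (- (u k ^+ 2 / (u l ^+ 2 * b j k ^+ 2)) * (b j k * b j l -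
    u j * b j k * b k l / u k + u j * u k * b j l * b k l / u l ^+ 2)).
    by rewrite /c /M /A /B /C; field; rewrite uk ul jk.
  by rewrite T mulr0.
have lkE' : c * b l k = - (B * B * C).
  have -> : c * b l k = - B * (c * b k l) by rewrite lkE /B; field; rewrite ul.
  by rewrite klE mulNr mulrA.
move=> x y; rewrite /stratum_entry inordK //.
case: x => [|[|[|[|//]]]]; case: y => [|[|[|[|//]]]] _ _ /=;
rewrite !(mevalM, mevalD, mevalN, mevalXU, meval0, meval1) ?inordK //=
  ?diag_eq0 ?ik ?il ?ji ?ki ?li ?klE ?lkE' -/M ?mulr0 //.
all: by rewrite ?kjE ?ljE /c /M /A /B /C; field; rewrite ?uk ?ul ?jk.
Qed.

(** The zero u_i kills b_ji, b_ki and b_li, so the quadrics at i make all products of two among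
    b_ij, b_ik, b_il vanish: two of these three are zero. *)
Lemma classify_kernel3 i j k l : uniq [:: i; j; k; l] ->
  u i = 0 -> u j != 0 -> u k != 0 -> u l != 0 -> goal.
Proof.
move=> u4 ui uj uk ul; uniq4_facts u4.
have ji := kernel_zero ui uj; have ki := kernel_zero ui uk; have li := kernel_zero ui ul.
have := triangle_eq nij nik njk; rewrite ji ki !sum0 => /mulf0 Tjk.
have := triangle_eq nij nil njl; rewrite ji li !sum0 => /mulf0 Tjl.
have := triangle_eq nik nil nkl; rewrite ki li !sum0 => /mulf0 Tkl.
have u4k : uniq [:: i; k; j; l] by uniq4_perm u4.
have u4l : uniq [:: i; l; j; k] by uniq4_perm u4.
case: Tjk => [ij|ik].
  case: Tkl => [ik|il].
    exact: classify_kernel3_sub u4l ui ul uj uk ij ik.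
  exact: classify_kernel3_sub u4k ui uk uj ul ij il.
case: Tjl => [ij|il].
  exact: classify_kernel3_sub u4l ui ul uj uk ij ik.
exact: classify_kernel3_sub u4 ui uj uk ul ik il.
Qed.

(** If b_il and b_jl both vanish, six entries remain, subject to b_ij b_ik + b_ji b_jk = 0, which
    gives b_ji when b_jk is nonzero. All other cases have at most five entries. *)
Lemma classify_kernel2_sub i j k l : uniq [:: i; j; k; l] ->
  u i = 0 -> u j = 0 -> u k != 0 -> u l != 0 -> b j l = 0 -> goal.
Proof.
move=> u4 ui uj uk ul jl; uniq4_facts u4.
have ki := kernel_zero ui uk; have li := kernel_zero ui ul.
have kj := kernel_zero uj uk; have lj := kernel_zero uj ul.
have := triangle_eq nij nil njl; rewrite jl li !sum0 => /mulf0 Tl.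
have := triangle_eq nik nil nkl; rewrite ki li !sum0 => /mulf0 Tkl.
have T := triangle_eq nij nik njk; rewrite ki !sum0 in T.
have [il|il] := eqVneq (b i l) 0; last first.
  have ij : b i j = 0 by case: Tl => // /eqP; rewrite (negPf il).
  have ik : b i k = 0 by case: Tkl => // /eqP; rewrite (negPf il).
  by_support u4 [:: (k, l); (l, k); (i, l); (j, i); (j, k)].
have [jk|jk] := eqVneq (b j k) 0.
  by_support u4 [:: (k, l); (l, k); (i, j); (j, i); (i, k)].
right; exists [tuple i; j; k; l], (inord 2), (b j k)^-1,
  (fun x => nth 0 [:: b i j / b j k; b i k / b j k; b k l / b j k; b l k / b j k] x).
split=> //; first by rewrite invr_eq0.
have jiE : b j i = - (b i j * b i k) / b j k.
  apply: (mulIf jk); rewrite divfK //; apply/eqP; rewrite -subr_eq0; apply/eqP.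
  by apply: (etrans _ T); ring.
move=> x y; rewrite /stratum_entry inordK //.
case: x => [|[|[|[|//]]]]; case: y => [|[|[|[|//]]]] _ _ /=;
rewrite !(mevalM, mevalD, mevalN, mevalXU, meval0, meval1) ?inordK //=
  ?diag_eq0 ?ki ?li ?kj ?lj ?il ?jl ?jiE; by field.
Qed.

Lemma classify_kernel2 i j k l : uniq [:: i; j; k; l] ->
  u i = 0 -> u j = 0 -> u k != 0 -> u l != 0 -> goal.
Proof.
move=> u4 ui uj uk ul; uniq4_facts u4.
have kj := kernel_zero uj uk; have lj := kernel_zero uj ul.
have := triangle_eq njk njl nkl; rewrite kj lj !sum0 => /mulf0 [jk|jl].
  have u4' : uniq [:: i; j; l; k] by uniq4_perm u4.
  exact: classify_kernel2_sub u4' ui uj ul uk jk.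
exact: classify_kernel2_sub u4 ui uj uk ul jl.
Qed.

(** With b_il = 0 two quadrics become b_ji b_jl = 0 and b_ki b_kl = 0. Either l is isolated or at
    most five entries survive. *)
Lemma classify_kernel1_sub i j k l : uniq [:: i; j; k; l] ->
  b l i = 0 -> b l j = 0 -> b l k = 0 -> b i l = 0 -> goal.
Proof.
move=> u4 li lj lk il; uniq4_facts u4.
have := triangle_eq nij nil njl; rewrite il li lj !sum0 => /mulf0 Tij.
have := triangle_eq nik nil nkl; rewrite il li lk !sum0 => /mulf0 Tik.
have Tjk := triangle_eq njk njl nkl; rewrite lj !sum0 in Tjk.
have T := triangle_eq nij nik njk.
have [jl|jl] := eqVneq (b j l) 0.
  have [kl|kl] := eqVneq (b k l) 0.
    have u4' : uniq [:: l; i; j; k] by uniq4_perm u4.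
    exact: isolated_vertex u4' _ _ _ _ _ _.
  have ki : b k i = 0 by case: Tik => // /eqP; rewrite (negPf kl).
  have kj : b k j = 0 by move: Tjk; rewrite jl !sum0 => /mulf0 [] // /eqP; rewrite (negPf kl).
  by_support u4 [:: (k, l); (i, j); (j, i); (i, k); (j, k)].
have ji : b j i = 0 by case: Tij => // /eqP; rewrite (negPf jl).
have [kl|kl] := eqVneq (b k l) 0.
  have jk : b j k = 0 by move: Tjk; rewrite kl !sum0 => /mulf0 [] // /eqP; rewrite (negPf jl).
  by_support u4 [:: (j, l); (i, j); (i, k); (k, i); (k, j)].
have ki : b k i = 0 by case: Tik => // /eqP; rewrite (negPf kl).
move: T; rewrite ji ki !sum0 => /mulf0 [ij|ik].
  by_support u4 [:: (j, l); (k, l); (j, k); (k, j); (i, k)].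
by_support u4 [:: (j, l); (k, l); (j, k); (k, j); (i, j)].
Qed.

Lemma classify_kernel1 i j k l : uniq [:: i; j; k; l] ->
  u i = 0 -> u j = 0 -> u k = 0 -> u l != 0 -> goal.
Proof.
move=> u4 ui uj uk ul; uniq4_facts u4.
have li := kernel_zero ui ul; have lj := kernel_zero uj ul; have lk := kernel_zero uk ul.
have u4j : uniq [:: j; i; k; l] by uniq4_perm u4.
have u4k : uniq [:: k; i; j; l] by uniq4_perm u4.
have [il|il] := eqVneq (b i l) 0; first exact: classify_kernel1_sub u4 li lj lk il.
have [jl|jl] := eqVneq (b j l) 0; first exact: classify_kernel1_sub u4j lj li lk jl.
have [kl|kl] := eqVneq (b k l) 0; first exact: classify_kernel1_sub u4k lk li lj kl.
have T := triangle_eq nij nik njk.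
have Tij := triangle_eq nij nil njl; rewrite li !sum0 in Tij.
have Tik := triangle_eq nik nil nkl; rewrite li !sum0 in Tik.
have Tjk := triangle_eq njk njl nkl; rewrite lj !sum0 in Tjk.
have [ki|ki] := eqVneq (b k i) 0.
  have ik : b i k = 0 by move: Tik; rewrite ki !sum0 => /mulf0 [] // /eqP; rewrite (negPf il).
  move: T; rewrite ik ki !sum0 => /mulf0 [ji|jk].
    have ij : b i j = 0 by move: Tij; rewrite ji !sum0 => /mulf0 [] // /eqP; rewrite (negPf il).
    by_support u4 [:: (i, l); (j, l); (k, l); (j, k); (k, j)].
  have kj : b k j = 0 by move: Tjk; rewrite jk !sum0 => /mulf0 [] // /eqP; rewrite (negPf kl).
  by_support u4 [:: (i, l); (j, l); (k, l); (i, j); (j, i)].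
have [ji|ji] := eqVneq (b j i) 0.
  have ij : b i j = 0 by move: Tij; rewrite ji !sum0 => /mulf0 [] // /eqP; rewrite (negPf il).
  have kj : b k j = 0 by move: T; rewrite ij ji !sum0 => /mulf0 [] // /eqP; rewrite (negPf ki).
  have jk : b j k = 0 by move: Tjk; rewrite kj !sum0 => /mulf0 [] // /eqP; rewrite (negPf jl).
  by_support u4 [:: (i, l); (j, l); (k, l); (i, k); (k, i)].
have solve (x y z w : K) : y != 0 -> x * y + z * w = 0 -> x = - (z * w) / y.
  move=> y0 E; apply: (mulIf y0); rewrite divfK //; apply/eqP; rewrite -subr_eq0; apply/eqP.
  by apply: (etrans _ E); ring.
have ijE := solve _ _ _ _ il Tij; have ikE := solve _ _ _ _ il Tik.
have kjE : b k j = - (b j k * b j l) / b k l by apply: solve; rewrite // addrC.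
pose x := b j l / b i l; pose y := b k l / b i l.
pose m2 := b k i / b i l; pose m3 := - b j i / b i l.
(* The quadrics through l give b_ij, b_ik and b_kj; the last quadric then becomes linear in b_jk,
   with coefficient [N] up to a nonzero factor. *)
pose N := y * m3 + x * m2.
have NE : N * b j k = - (x * y * y * m2 * m3) * b i l.
  apply/eqP; rewrite -subr_eq0; apply/eqP.
  transitivity (- (b k l / b i l ^+ 2) * (b i j * b i k + b j i * b j k + b k i * b k j));
    last by rewrite T mulr0.
  by rewrite ijE ikE kjE /N /x /y /m2 /m3; field; rewrite il kl.
have N0 : N != 0.
  apply/eqP => N0; move/eqP: NE; rewrite N0 mul0r eq_sym; apply/negP.
  by rewrite !(mulf_neq0, oppr_eq0) ?invr_eq0.
right; exists [tuple i; j; k; l], (inord 3), (N / b i l),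
  (fun a => nth 0 [:: x; y; m2; m3] a).
split=> //; first by apply: mulf_neq0; rewrite ?invr_eq0.
have jkE : N / b i l * b j k = - (x * y * y * m2 * m3).
  by rewrite mulrAC NE mulfK.
have kjE' : N / b i l * b k j = x * x * y * m2 * m3.
  have -> : N / b i l * b k j = - (b j l / b k l) * (N / b i l * b j k).
    by rewrite kjE; field; rewrite il kl.
  by rewrite jkE /x /y; field; rewrite il kl.
move=> a d; rewrite /stratum_entry inordK //.
case: a => [|[|[|[|//]]]]; case: d => [|[|[|[|//]]]] _ _ /=;
rewrite !(mevalM, mevalD, mevalN, mevalXU, meval0, meval1) ?inordK //=
  ?diag_eq0 ?li ?lj ?lk ?jkE ?kjE' -/N ?mulr0 //.
all: by rewrite ?ijE ?ikE /x /y /m2 /m3; field; rewrite ?il ?kl.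
Qed.

Lemma uniq4_extend (i j : 'I_4) : i != j -> exists k l, uniq [:: i; j; k; l].
Proof.
move=> nij; pose r := rem j (rem i (enum 'I_4)).
have E : perm_eq (enum 'I_4) [:: i, j & r].
  apply: (perm_trans (perm_to_rem (mem_enum _ i))); rewrite perm_cons perm_to_rem //.
  by rewrite rem_filter ?enum_uniq // mem_filter /= eq_sym nij mem_enum.
have := perm_size E; rewrite size_enum_ord; have := enum_uniq 'I_4; rewrite (perm_uniq E).
by case: r {E} => [|k [|l [|? ?]]] // u4 _; exists k, l.
Qed.

Lemma classify : (exists i, u i != 0) -> (exists i j, i != j /\ b i j = 0) -> goal.
Proof.
move=> [i0 ui0] [i [j [nij bij]]].
(* Listing the zeros of [u] first yields the order of indices that the case lemmas expect. *)
pose z := [seq x <- enum 'I_4 | u x == 0]; pose nz := [seq x <- enum 'I_4 | u x != 0].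
have E : perm_eq (z ++ nz) (enum 'I_4) by exact: (permEl (perm_filterC _ _)).
have := perm_size E; rewrite size_enum_ord; have := enum_uniq 'I_4; rewrite -(perm_uniq E).
have: i0 \in nz by rewrite mem_filter ui0 mem_enum.
have: all (fun x => u x == 0) z by apply: filter_all.
have: all (fun x => u x != 0) nz by apply: filter_all.
case: (z) => [|a [|d [|e [|f [|? ?]]]]];
  case: (nz) => [|a' [|d' [|e' [|f' [|? ?]]]]] // nzP zP _ u4 _.
- have [k [l u4']] := uniq4_extend nij; apply: classify_full u4' _ bij => x.
  by case: (uniq4_cases u4 x) => ->; move: nzP => /= /and5P [].
- by move: zP nzP => /= /andP [/eqP ? _] /and4P [? ? ? _]; apply: classify_kernel3 u4 _ _ _ _.
- by move: zP nzP => /= /and3P [/eqP ? /eqP ? _] /and3P [? ? _]; apply: classify_kernel2 u4 _ _ _ _.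
- by move: zP nzP => /= /and4P [/eqP ? /eqP ? /eqP ? _] /andP [? _];
  apply: classify_kernel1 u4 _ _ _ _.
Qed.

End Classification.

Lemma covered_degenerate : covered 4 (fun q : pt K 12 => Xhyp q /\ ~ torus q).
Proof.
apply: (covered_monomial (rho := edge_ends)
  (e := fun k => edge_sign (edge_ends k).1 (edge_ends k).2)) covered_strata
  => q [/XhypP [nzq Q [u nzu ker]] ntq].
have E k : q k = edge_sign (edge_ends k).1 (edge_ends k).2 *
  edge_val q (edge_ends k).1 (edge_ends k).2 by exact: edge_val_ends.
exists (fun p => edge_val q p.1 p.2) => //.
apply: (classify (symmetric_eqs_edge_val Q ker)) => //.
  have [k qk] := nzq; exists (edge_ends k).1, (edge_ends k).2 => e0.
  by apply: qk; rewrite E e0 mulr0.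
have [k qk] : exists k, q k = 0.
  by apply: NNPP => H; apply: ntq => k; apply/eqP => qk; apply: H; exists k.
exists (edge_ends k).1, (edge_ends k).2; split.
  by elim/ord12P: k {qk}; rewrite /edge_ends -val_eqE /= !inordK //=.
move/eqP: qk; rewrite E mulf_eq0 => /orP [|/eqP //].
by rewrite /edge_sign; case: ifP; rewrite ?oppr_eq0 oner_eq0.
Qed.

End Degenerate.

(** * Identification of the component and its birational parametrization *)

Theorem theorem2p9 (K : closedFieldType) (char0 : [pchar K] =i pred0)
    (V : pset K 12) (hV : irr_component (@Xhyp K) V) (dimV : pdim V 5) :
  (forall p : pt K 10, relevant p -> nonzero (Phi p) -> V (Phi p)) /\
  exists (Psi : 'I_10 -> {mpoly K[12]}) (h : {mpoly K[10]}) (g : {mpoly K[12]}),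
    h <> 0 /\ (exists q, V q /\ g.@[q] <> 0) /\
    (forall p : pt K 10, h.@[p] <> 0 -> sequiv p (evalPsi Psi (Phi p))) /\
    (forall q, V q -> g.@[q] <> 0 -> pequiv q (Phi (evalPsi Psi q))) /\
    (forall q (l : K), V q -> g.@[q] <> 0 -> l <> 0 ->
        sequiv (evalPsi Psi q) (evalPsi Psi (pscale l q))).
Proof.
have torus_poly0 := torus_poly_neq0 char0; have [irrV [VX _]] := hV.
have [q [Vq tq]] : exists q, V q /\ torus q.
  (* Without a torus point, [V] would be covered by four-parameter families and could not contain a
     chain of length 5. *)
  apply: NNPP => H.
  apply: (covered_no_chain (k := 4) (covered_sub _ (covered_degenerate K))) dimV.1.
  by move=> v Vv; split; [exact: VX | move=> tv; apply: H; exists v].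
have VW := component_image_closure torus_poly0 hV Vq tq.
split=> [p _ nz|]; first by apply/VW/image_closure_Phi.
have gE w : (coord_prod K).@[w] <> 0 -> torus w by move/eqP/meval_coord_prod.
exists (inversePhi K), (torus_poly K), (coord_prod K).
split; [|split; [|split; [|split]]].
- exact/eqP.
- by exists q; split=> //; apply/eqP/meval_coord_prod.
- by move=> p /eqP; apply: inversePhiK.
- move=> w Vw /gE tw; have [l l0 E] := PhiK (VX _ Vw) tw.
  by split; [exact: torus_nonzero | exists l; split; first exact/eqP].
- by move=> w l Vw /gE tw /eqP; apply: inversePhi_scale.
Qed.
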